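(* Let $\theta,\gamma\in(0,1)$ satisfy $\theta<(3-\sqrt5)/2$ and $\gamma>(\sqrt5-1)/2$, and let $\{G_{\ell,\theta,\gamma}(\mathbf w_n)\}_{n\ge1}$ be an $(\ell,\theta,\gamma)$-strongly heterogeneous sequence of ensembles with associated constant $c_0$. There exists a positive constant $c=c(H,\max_{i\ge1}\|V_i\|,c_0)$ such that if $\alpha_0>c$ and $\alpha=\alpha_0/\max_{1\le k\le n}w_k$, then the coupled equations $$\dot X=[V(t)-\alpha L\otimes H]X$$ on almost every graph of $G_{\ell,\theta,\gamma}(\mathbf w_n)$ admit an exponential dichotomy in which the dimension of the stable subspace is exactly $d\times\ell(n)$. (That is, the probability that this holds tends to $1$ as $n\to\infty$.)
   Context: **Random graphs.** For each $n$ let $\mathbf w_n=(w_1,\dots,w_n)$ (the $w_i=w_i(n)$ may depend on $n$) with $\max_k w_k=w_1\ge w_2\ge\dots\ge w_n>0$ and $(\max_{1\le k\le n}w_k)^2\le\sum_{k=1}^n w_k$. The ensemble (probability space) $G(\mathbf w_n)$ consists of random labelled undirected graphs on nodes $1,\dots,n$ in which an edge between $i$ and $j$ (loops $i=j$ allowed) is present independently with probability $p_{ij}=w_iw_j/\sum_k w_k$. $A=(A_{ij})$ is the symmetric $(0,1)$ adjacency matrix; the degree is $\kappa_i=\sum_j A_{ij}$, whose expected value is $w_i$. **Strong heterogeneity.** Let $\ell:\mathbb N\to\mathbb N$ be non-decreasing ($\ell(n)\ge1$) and $\theta,\gamma\in(0,1)$. A sequence of ensembles $\{G(\mathbf w_n)\}_{n\ge1}$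 is $(\ell,\theta,\gamma)$-strongly heterogeneous, and then denoted $G_{\ell,\theta,\gamma}(\mathbf w_n)$, if, with constants independent of $n$: - there is $\Gamma_0>0$ with $\ell(n)<\Gamma_0(\max_{1\le k\le n}w_k)^\theta$; - there is $c_0\in(0,1/2]$ with $\liminf_{n\to\infty} w_{\ell(n)}/\max_{1\le k\le n}w_k=2c_0$; - there are $\Gamma_1,\Gamma_2>0$ and $\beta>0$ such that $\Gamma_1(\log n)^{1+\beta}<w_i<\Gamma_2(\max_{1\le k\le n}w_k)^{1-\gamma}$ for every $i\in\{\ell(n)+1,\dots,n\}$. **Equations.** Fix $d\ge1$, a (symmetric) positive-definite real $d\times d$ matrix $H$, and a sequence $(V_i)_{i\ge1}$ of continuous bounded maps $t\in\mathbb R\mapsto V_i(t)\in\mathbb R^{d\times d}$ with $\max_{i\ge1}\|V_i\|<+\infty$, where $\|V_i\|=\sup_{t>0}\|V_i(t)\|$. The isolated equations $\dot x_i=V_i(t)x_i$, with evolution operators $T_i(t,s)$ (so $x_i(t)=T_i(t,s)x_i(s)$), are assumed unstable: there are constants $\eta_0,K_0>0$, common to all $i$, with $\|T_i^{-1}(t,s)\|\le K_0e^{-\eta_0(t-s)}$ for all $t>s$. Norms are Euclidean and induced operator norms; $T^{-1}(t,s)=(T(t,s))^{-1}$. For coupling strength $\alpha$, the coupled equations are $\dot x_i=V_i(t)x_i+\alpha\sum_{j=1}^nA_{ij}[H x_j-Hx_i]$, $i=1,\dots,n$; in block form with $X=\mathrm{col}(x_1,\dots,x_n)\in\mathbb R^{nd}$,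 $V(t)=\mathrm{diag}(V_1(t),\dots,V_n(t))$, $L_{ij}=\delta_{ij}\kappa_i-A_{ij}$ and $\otimes$ the Kronecker product, they read $\dot X=[V(t)-\alpha L\otimes H]X$. $T(t,s)$ is the evolution operator: $X(t)=T(t,s)X(s)$. **Exponential dichotomy** on $\mathbb R_+$: there are a family of projectors $P(t)$ with $P(t)T(t,s)=T(t,s)P(s)$ for $t\ge s>0$ and constants $K,\eta>0$ such that for all $t\ge s\ge0$, $\|T(t,s)P(s)\|\le Ke^{-\eta(t-s)}$ and $\|T^{-1}(t,s)(I-P)(t)\|\le Ke^{-\eta(t-s)}$. The dimension of the stable subspace is the (constant) rank of $P(t)$. The notation $c=c(H,\max_{i\ge1}\|V_i\|,c_0)$ means $c$ depends only on these quantities; $\alpha_0$ (normalized coupling strength) does not depend on $n$. *)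

(* Defs.v *)
From mathcomp Require Export all_boot all_order all_algebra.
From mathcomp Require Export mxtens.
From mathcomp Require Export all_classical all_reals all_analysis.

Set Implicit Arguments.
Unset Strict Implicit.
Unset Printing Implicit Defensive.

Export Order.TTheory GRing.Theory Num.Theory.
Export numFieldNormedType.Exports.

Local Open Scope classical_set_scope.
Local Open Scope ring_scope.

(* The norm that the library puts on matrices is the max-entry norm; it is used
   below only as a topology (continuity, derivatives).  All quantitative bounds
   are in the Euclidean norm and its induced operator norm. *)
Definition enorm (R : realType) (m : nat) (x : 'cV[R]_m) : R :=
  Num.sqrt (\sum_i x i 0 ^+ 2).

Definition opnorm (R : realType) (m : nat) (A : 'M[R]_m) : R :=
  sup [set enorm (A *m x) | x in [set x : 'cV[R]_m | enorm x <= 1]].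

Definition posdef (R : realType) (m : nat) (H : 'M[R]_m) : Prop :=
  H^T = H /\ forall x : 'cV[R]_m, x != 0 -> 0 < (x^T *m H *m x) 0 0.

Definition evolution_operator (R : realType) (m : nat) (W : R -> 'M[R]_m)
    (T : R -> R -> 'M[R]_m) : Prop :=
  (forall s, T s s = 1%:M) /\
  (forall t s, is_derive t (1 : R) (fun u => T u s) (W t *m T t s)).

(* Dichotomy on [0, +oo[; [r] is the dimension of the stable subspace, i.e. the
   rank of the projectors.  [P t] for [t < 0] is irrelevant. *)
Definition exponential_dichotomy (R : realType) (m : nat) (W : R -> 'M[R]_m)
    (r : nat) : Prop :=
  exists T : R -> R -> 'M[R]_m, evolution_operator W T /\
  exists (P : R -> 'M[R]_m) (K eta : R), [/\ 0 < K, 0 < eta,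
    (forall t, 0 <= t -> P t *m P t = P t /\ \rank (P t) = r),
    (forall t s, 0 <= s -> s <= t -> P t *m T t s = T t s *m P s) &
    (forall t s, 0 <= s -> s <= t ->
       opnorm (T t s *m P s) <= K * expR (- eta * (t - s)) /\
       opnorm (invmx (T t s) *m (1%:M - P t)) <= K * expR (- eta * (t - s)))].

(* Families ([V], [w]) are indexed from 1: node [k : 'I_n] carries index [k.+1];
   the values at index 0 are irrelevant. *)

Definition fnorm (R : realType) (d : nat) (U : R -> 'M[R]_d) : R :=
  sup [set opnorm (U t) | t in [set t : R | 0 < t]].

(* [M] is the (finite) supremum over [i >= 1] of the [fnorm (V i)]; it need not
   be attained. *)
Definition bounded_fields (R : realType) (d : nat) (V : nat -> R -> 'M[R]_d)
    (M : R) : Prop :=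
  [/\ (forall i, (1 <= i)%N -> continuous (V i)),
      (forall i, (1 <= i)%N -> exists B : R, forall t, opnorm (V i t) <= B) &
      ereal_sup [set (fnorm (V i))%:E | i in [set i : nat | (1 <= i)%N]] = M%:E].

Definition uniformly_unstable (R : realType) (d : nat)
    (V : nat -> R -> 'M[R]_d) : Prop :=
  exists eta0 K0 : R, [/\ 0 < eta0, 0 < K0 &
    forall i, (1 <= i)%N -> exists T : R -> R -> 'M[R]_d,
      evolution_operator (V i) T /\
      forall t s, s < t ->
        opnorm (invmx (T t s)) <= K0 * expR (- eta0 * (t - s))].

Definition wmax (R : realType) (w : nat -> nat -> R) (n : nat) : R :=
  \big[Num.max/0]_(1 <= k < n.+1) w n k.

Definition wsum (R : realType) (w : nat -> nat -> R) (n : nat) : R :=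
  \sum_(1 <= k < n.+1) w n k.

Definition admissible_weights (R : realType) (w : nat -> nat -> R) : Prop :=
  forall n, (1 <= n)%N ->
    [/\ (forall i, (1 <= i <= n)%N -> 0 < w n i),
        (forall i j, (1 <= i)%N -> (i <= j)%N -> (j <= n)%N -> w n j <= w n i) &
        wmax w n ^+ 2 <= wsum w n].

(* Labelled undirected graphs with loops allowed: symmetric boolean matrices. *)
Definition graph (n : nat) : finType := {g : 'M[bool]_n | g^T == g}.

Definition edge_prob (R : realType) (w : nat -> nat -> R) (n : nat)
    (i j : 'I_n) : R :=
  w n i.+1 * w n j.+1 / wsum w n.

(* One Bernoulli factor for each unordered pair {i, j}, loops included. *)
Definition graph_weight (R : realType) (w : nat -> nat -> R) (n : nat)
    (g : graph n) : R :=
  \prod_(i < n) \prod_(j < n | (i <= j)%N)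
     (if val g i j then edge_prob w i j else 1 - edge_prob w i j).

Definition graph_prob (R : realType) (w : nat -> nat -> R) (n : nat)
    (E : set (graph n)) : R :=
  \sum_(g : graph n | `[< E g >]) graph_weight w g.

Definition almost_every_graph (R : realType) (w : nat -> nat -> R)
    (E : forall n, set (graph n)) : Prop :=
  graph_prob w (E n) @[n --> \oo] --> (1 : R).

Definition adjacency (R : realType) (n : nat) (g : graph n) : 'M[R]_n :=
  \matrix_(i, j) (val g i j)%:R.

Definition degree (R : realType) (n : nat) (g : graph n) (i : 'I_n) : R :=
  \sum_j adjacency R g i j.

Definition laplacian (R : realType) (n : nat) (g : graph n) : 'M[R]_n :=
  \matrix_(i, j) ((i == j)%:R * degree R g i - adjacency R g i j).

Definition strongly_heterogeneous (R : realType) (w : nat -> nat -> R)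
    (l : nat -> nat) (theta gamma c0 : R) : Prop :=
  [/\ [/\ admissible_weights w, 0 < theta < 1 & 0 < gamma < 1],
      (forall m n, (1 <= m)%N -> (m <= n)%N -> (1 <= l m)%N /\ (l m <= l n)%N),
      (exists Gamma0 : R, 0 < Gamma0 /\
         forall n, (1 <= n)%N -> (l n)%:R < Gamma0 * wmax w n `^ theta),
      (0 < c0 <= 2^-1 /\
       limn_einf (fun n => (w n (l n) / wmax w n)%:E) = (2 * c0)%:E) &
      (exists Gamma1 Gamma2 beta : R, [/\ 0 < Gamma1, 0 < Gamma2, 0 < beta &
         forall n i, (1 <= n)%N -> (l n < i <= n)%N ->
           Gamma1 * (ln n%:R) `^ (1 + beta) < w n i /\
           w n i < Gamma2 * wmax w n `^ (1 - gamma)])].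

(* [V(t) - alpha L (x) H], where [delta_mx i i *t B] is the block matrix whose
   only nonzero block is [B] at diagonal position [i]. *)
Definition coupled_field (R : realType) (d : nat) (H : 'M[R]_d)
    (V : nat -> R -> 'M[R]_d) (alpha : R) (n : nat) (g : graph n) (t : R) :
    'M[R]_(n * d) :=
  \sum_(i < n) (delta_mx i i *t V i.+1 t) - alpha *: (laplacian R g *t H).

(* Main.v *)
Require Import Defs.
From mathcomp Require Import ring lra.

(** Rescaled by the maximal weight [D = wmax w n], the coupling splits the nodes into
    two groups.  The degrees of the hubs are of order [D], so the term
    [- alpha * kappa_i * H] dominates [V_i] once [alpha0] is large: by itself, a hub is
    contracted at rate at least 1.  All other nodes have degrees [o(D)] and hardly feel
    the coupling, so that they keep the instability of the isolated equations.  The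
    interactions between the groups are [o(1)] in operator norm: the adjacency rows of
    the hubs have entries 0 or 1, row sums [O(D)] and column sums at most
    [l n = o(D)], those of the other nodes have row sums [o(D)] and column sums [O(D)],
    and by the Schur test ([schur_test]) the norm of such a block is at most the
    geometric mean of the two bounds.  The coupled equation is thus a small perturbation of a
    decoupled one with an obvious dichotomy, whose stable subspace consists of the
    [d * l n] hub coordinates.

    Three ingredients turn this into a proof.

    - Degrees concentrate.  By independence the moment generating function of a degree
      factorises ([degree_mgf]), the resulting Chernoff bounds are exponentially small
      in [D], and [D] dominates every multiple of [ln n] ([near_log_le_wmax]), so a union
      bound over the nodes suffices ([almost_every_graph_concentrated]).

    - Dichotomies persist under small coupling, with a threshold independent of the
      dimension ([exists_coupling_threshold]).  Over a time step [tau] that is long with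
      respect to the rates of the two groups, the squared norms [a], [b] of the hub and
      non-hub components satisfy [16 a' <= 2 a + b] and [15 b <= b' + a]
      ([dissipative_step], [expansive_step]).  Hence the cones [a <= b] and [b <= a] are
      invariant, forwards and backwards; the stable subspace at time 0 is the limit of
      the subspaces that are mapped onto the hub coordinates after [k] steps, each of
      which is a graph over the hub coordinates ([exists_stable_projection]).  The limit
      is again such a graph, which gives the dimension; since the dichotomy is on a
      half-line, the non-hub coordinates can serve as the unstable complement at time 0.

    - Linear equations with bounded continuous coefficients have a fundamental solution
      together with its inverse, defined on the whole line ([exists_fundamental_pair]). *)

Set Implicit Arguments.
Unset Strict Implicit.
Unset Printing Implicit Defensive.

Local Open Scope classical_set_scope.
Local Open Scope ring_scope.

(** * Primitives and differential inequalities on the line *)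

Section Calculus.
Variable R : realType.
Implicit Types f F : R -> R.

Lemma is_derive_continuous f (df t : R) : is_derive t 1 f df -> {for t, continuous f}.
Proof. by move=> [/derivable1_diffP /differentiable_continuous]. Qed.

Lemma nonincreasing_is_derive f df (a b : R) : a <= b ->
  (forall t, a <= t <= b -> is_derive t 1 f (df t)) ->
  (forall t, a < t < b -> df t <= 0) -> f b <= f a.
Proof.
move=> ab dfE df0.
move: ab; rewrite le_eqVlt => /predU1P[<- //|ab].
have [||c] := @MVT R f df a b ab.
- move=> x; rewrite in_itv/= => /andP[ax xb].
  by apply: dfE; rewrite !ltW.
- apply: derivable_within_continuous => x; rewrite in_itv/= => xab.
  by case: (dfE _ xab).
rewrite in_itv/= => cab fba.
by rewrite -subr_le0 fba mulr_le0_ge0 ?df0 // subr_ge0 ltW.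
Qed.

Lemma constant_is_derive f (a b : R) :
  (forall t, Num.min a b <= t <= Num.max a b -> is_derive t 1 f 0) -> f a = f b.
Proof.
wlog ab : a b / a <= b.
  move=> H; case/orP: (le_total a b) => [/H//|ba] fE.
  by apply/esym/H => // t; rewrite minC maxC; exact: fE.
rewrite (min_idPl ab) (max_idPr ab) => fE; apply/eqP; rewrite eq_le.
apply/andP; split; last exact: (@nonincreasing_is_derive f (fun=> 0) a b ab fE).
rewrite -lerN2; apply: (@nonincreasing_is_derive (fun x => - f x) (fun=> - 0) a b ab).
  by move=> t /fE ?; apply: is_deriveN.
by move=> t _; rewrite oppr0.
Qed.

(** Integration from a base point [a] gives a primitive on [a, +oo[ only.  Normalised
    to vanish at 0, its value at [x] does not depend on [a], and near a given point
    a single base point can be used. *)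
Lemma exists_primitive f : continuous f ->
  exists F, F 0 = 0 /\ forall t : R, is_derive t 1 F (f t).
Proof.
move=> fc.
pose mu := @lebesgue_measure R.
pose G (a x : R) := (\int[mu]_(t in [set` `[a, x]]) f t)%R.
have dG (a x : R) : a < x -> is_derive x 1 (G a) (f x).
  move=> ax; have xu : x < x + 1 by rewrite ltrDl.
  have fi : mu.-integrable `[a, x + 1] (EFin \o f).
    apply: continuous_compact_integrable; first exact: segment_compact.
    exact: continuous_subspaceT.
  have [dF] := continuous_FTC1_closed xu fi ax (fc x).
  by rewrite derive1E => FE; apply: DeriveDef.
pose J (a x : R) := G a x - G a 0.
have dJ (a x : R) : a < x -> is_derive x 1 (J a) (f x).
  move=> ax; rewrite -[f x]subr0; apply: is_deriveB; exact: dG.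
have JJ (a b x : R) : a < 0 -> b < 0 -> a < x -> b < x -> J a x = J b x.
  move=> a0 b0 ax bx; apply/eqP; rewrite -subr_eq0; apply/eqP.
  suff -> : J a x - J b x = J a 0 - J b 0 by rewrite /J !subrr.
  apply: (@constant_is_derive (fun x => J a x - J b x) x 0) => t /andP[+ _]; rewrite ge_min => tx.
  have [at_ bt] : a < t /\ b < t.
    by case/orP: tx => tx; split; apply: lt_le_trans tx.
  by rewrite -[0](subrr (f t)); apply: is_deriveB; apply: dJ.
exists (fun x => J (- `|x| - 1) x); split; first by rewrite /J subrr.
move=> t.
apply: (@near_eq_is_derive _ _ _ (J (- `|t| - 2))) (dJ _ _ _).
- near=> u.
  have ut : `|t - u| < 1 by near: u; apply: cvgr_dist_lt.
  move: (ler_normD (t - u) u) (ler_norm (- u)) (ler_norm (- t)) (normr_ge0 u)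
    (normr_ge0 t) (ler_normD (u - t) t).
  rewrite !subrK !normrN (distrC u t) => ? ? ? ? ? ?.
  apply: JJ; lra.
- move: (ler_norm (- t)); rewrite normrN; lra.
Unshelve. all: by end_near.
Qed.

Lemma is_derive_expRM (k c t : R) :
  is_derive t 1 (fun u => k * expR (c * u)) (k * (c * expR (c * t))).
Proof.
have dlin : is_derive t 1 (fun u : R => c * u) c.
  have : is_derive t 1 (c \*: @id R) (c *: 1) by apply: is_deriveZ.
  by rewrite /GRing.scale/= mulr1.
rewrite [c * expR _]mulrC.
have /= := @is_deriveZ _ _ _ (fun u => expR (c * u)) k t 1 (expR (c * t) * c).
by apply; apply: (@is_derive1_comp _ expR (fun u => c * u)).
Qed.

(** Integration gains a factor [1 / c] in the norm that weighs [t] by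
    [expR (- c * `|t|)]: this is what makes Picard iteration contract on the whole
    line at once. *)
Lemma primitive_expR_bound f F (K c : R) : 0 < c -> F 0 = 0 ->
  (forall t : R, is_derive t 1 F (f t)) -> (forall t, `|f t| <= K * expR (c * `|t|)) ->
  forall t, `|F t| <= K / c * expR (c * `|t|).
Proof.
move=> c0.
have K0 (h : R -> R) : (forall t, `|h t| <= K * expR (c * `|t|)) -> 0 <= K.
  by move=> /(_ 0); rewrite normr0 mulr0 expR0 mulr1; apply: le_trans.
have main (h H : R -> R) (t : R) : H 0 = 0 -> (forall t : R, is_derive t 1 H (h t)) ->
  (forall t, `|h t| <= K * expR (c * `|t|)) -> 0 <= t -> H t <= K / c * expR (c * t).
  move=> H0 dH hb t0; have kp := K0 _ hb.
  have /(_ t t0) := @nonincreasing_is_derive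
    (fun u => H u - K / c * expR (c * u)) (fun u => h u - K * expR (c * u)) 0.
  rewrite H0 mulr0 expR0 mulr1 sub0r => hh.
  suff : H t - K / c * expR (c * t) <= - (K / c).
    have : 0 <= K / c by rewrite divr_ge0 // ltW.
    lra.
  apply: hh => [u _|u /andP[u0 _]].
    apply: is_deriveB.
    have -> : K * expR (c * u) = K / c * (c * expR (c * u)).
      by rewrite mulrA divfK // gt_eqF.
    exact: is_derive_expRM.
  rewrite subr_le0; apply: le_trans (ler_norm _) _.
  by rewrite -[in leRHS](ger0_norm (ltW u0)).
move=> F0 dF fb.
have pos (t : R) : 0 <= t -> `|F t| <= K / c * expR (c * t).
  move=> t0; rewrite ler_norml; apply/andP; split; last exact: (main f F).
  rewrite lerNl; apply: (main (fun u => - f u) (fun u => - F u)) => //.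
  - by rewrite F0 oppr0.
  - by move=> u; rewrite normrN.
have neg (t : R) : 0 <= t -> `|F (- t)| <= K / c * expR (c * t).
  have dF' (u : R) : is_derive u 1 (fun u => F (- u)) (- f (- u)).
    have := @is_derive1_comp _ F (fun u => - u) u (f (- u)) (-1) (dF _) _.
    by rewrite mulrN mulr1; apply; apply: is_deriveNid.
  move=> t0; rewrite ler_norml; apply/andP; split.
    rewrite lerNl; apply: (main (fun u => f (- u)) (fun u => - F (- u))) => //.
    - by rewrite oppr0 F0 oppr0.
    - by move=> u; have := dF' u => ?; rewrite -[f _]opprK; apply: is_deriveN.
    - by move=> u; rewrite -[X in expR (c * X)]normrN.
  apply: (main (fun u => - f (- u)) (fun u => F (- u))) => //.
  - by rewrite oppr0 F0.
  - by move=> u; rewrite normrN -[X in expR (c * X)]normrN.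
move=> t; have [t0|t0] := leP 0 t; first by rewrite [X in c * X]ger0_norm // pos.
by rewrite -[in leLHS](opprK t) [X in c * X]ltr0_norm // neg // oppr_ge0 ltW.
Qed.

Lemma cvg_geometric_increments (u : nat -> R) (C : R) :
  (forall k, `|u k.+1 - u k| <= C * 2^-1 ^+ k) ->
  exists l, u @ \oo --> l /\ forall k, `|u k - l| <= 2 * C * 2^-1 ^+ k.
Proof.
move=> uC.
have C0 : 0 <= C by have := uC 0; rewrite expr0 mulr1; apply: le_trans.
have um k m : `|u (k + m)%N - u k| <= 2 * C * 2^-1 ^+ k * (1 - 2^-1 ^+ m).
  elim: m => [|m IH]; first by rewrite addn0 subrr normr0 expr0 subrr mulr0.
  have -> : u (k + m.+1)%N - u k = (u (k + m).+1 - u (k + m)%N) + (u (k + m)%N - u k).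
    by rewrite addnS subrKA.
  apply: le_trans (ler_normD _ _) _; apply: le_trans (lerD (uC _) IH) _.
  rewrite exprD exprS; set a := _ ^+ k; set b := _ ^+ m.
  suff -> : C * (a * b) + 2 * C * a * (1 - b) = 2 * C * a * (1 - 2^-1 * b) by [].
  by field.
have um' k m : `|u (k + m)%N - u k| <= 2 * C * 2^-1 ^+ k.
  apply: le_trans (um k m) _; rewrite ler_piMr //.
  by rewrite !mulr_ge0 ?exprn_ge0 ?invr_ge0.
have cu : cvg (u @ \oo).
  apply/cauchy_cvgP/cauchy_exP => e e0.
  have := @cvg_geometric R (2 * C) 2^-1 _.
  rewrite ger0_norm ?invr_ge0 // invf_lt1 ?ltr1n // => /(_ isT).
  have e20 : 0 < e / 2 by rewrite divr_gt0.
  move/cvgrPdist_lt => /(_ _ e20) [N _ /(_ N (leqnn _))] /=.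
  rewrite sub0r normrN => /(le_lt_trans (ler_norm _)) CN.
  exists (u N), N => // n /= Nn; rewrite -ball_normE /= distrC -(subnKC Nn).
  apply: le_lt_trans (um' N _) (lt_le_trans CN _).
  by rewrite ler_pdivrMr // ler_peMr ?ltW // ltr1n.
exists (lim (u @ \oo)); split => // k.
have cd : `|u k - u m| @[m --> \oo] --> `|u k - lim (u @ \oo)|.
  by apply: cvg_norm; apply: cvgB => //; apply: cvg_cst.
apply: (cvgr_to_le cd).
exists k => // m /= km; rewrite distrC -(subnKC km); exact: um'.
Qed.
End Calculus.

(** * Linear differential equations *)

Section MatrixCalculus.
Variable R : realType.
Implicit Types t u s : R.

Lemma is_derive_mxP m n (X : R -> 'M[R]_(m, n)) dX (t : R) :
  is_derive t 1 X dX <-> forall i j, is_derive t 1 (fun u => X u i j) (dX i j).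
Proof.
split=> [[dX1 <-] i j|H].
  apply: DeriveDef; first by move/derivable_mxP: dX1; apply.
  by rewrite derive_mx // mxE.
have dX1 : derivable X t 1 by apply/derivable_mxP => i j; case: (H i j).
apply: DeriveDef => //; rewrite derive_mx //; apply/matrixP => i j.
by rewrite mxE; case: (H i j).
Qed.

Lemma is_derive_sum_ord n (h : 'I_n -> R -> R) (dh : 'I_n -> R) (t : R) :
  (forall i, is_derive t 1 (h i) (dh i)) ->
  is_derive t 1 (fun u => \sum_i h i u) (\sum_i dh i).
Proof.
move=> H; have /= := @is_derive_sum _ _ _ n h t 1 dh H.
by rewrite (_ : \sum_i h i = fun u => \sum_i h i u) // funeqE => u; rewrite fct_sumE.
Qed.

Lemma is_derive_mulf (f g : R -> R) (df dg t : R) :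
  is_derive t 1 f df -> is_derive t 1 g dg ->
  is_derive t 1 (fun u => f u * g u) (df * g t + f t * dg).
Proof.
move=> Hf Hg; have /= H := is_deriveM Hf Hg.
by apply: is_derive_eq H _; rewrite /GRing.scale/= addrC [g t * _]mulrC.
Qed.

Lemma is_derive_mulmx m n p (X : R -> 'M[R]_(m, n)) (Y : R -> 'M[R]_(n, p)) dX dY
    (t : R) :
  is_derive t 1 X dX -> is_derive t 1 Y dY ->
  is_derive t 1 (fun u => X u *m Y u) (dX *m Y t + X t *m dY).
Proof.
move=> /is_derive_mxP dXE /is_derive_mxP dYE; apply/is_derive_mxP => i j.
rewrite (_ : (fun u => (X u *m Y u) i j) = fun u => \sum_k X u i k * Y u k j); last first.
  by rewrite funeqE => u; rewrite mxE.
rewrite !mxE -big_split /=.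
by apply: is_derive_sum_ord => k; apply: is_derive_mulf.
Qed.

Lemma is_derive_mx_cst m n (A : 'M[R]_(m, n)) (t : R) : is_derive t 1 (fun=> A) 0.
Proof. exact: is_derive_cst. Qed.

Lemma is_derive_mulmxl m n p (A : 'M[R]_(m, n)) (Y : R -> 'M[R]_(n, p)) dY (t : R) :
  is_derive t 1 Y dY -> is_derive t 1 (fun u => A *m Y u) (A *m dY).
Proof.
by move=> /(is_derive_mulmx (is_derive_mx_cst A t)); rewrite mul0mx add0r.
Qed.

Lemma is_derive_mulmxr m n p (A : 'M[R]_(n, p)) (X : R -> 'M[R]_(m, n)) dX (t : R) :
  is_derive t 1 X dX -> is_derive t 1 (fun u => X u *m A) (dX *m A).
Proof.
by move=> /is_derive_mulmx /(_ (is_derive_mx_cst A t)); rewrite mulmx0 addr0.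
Qed.

Lemma is_derive_trmx m n (X : R -> 'M[R]_(m, n)) dX (t : R) :
  is_derive t 1 X dX -> is_derive t 1 (fun u => (X u)^T) dX^T.
Proof.
move=> /is_derive_mxP H; apply/is_derive_mxP => i j; rewrite mxE.
by rewrite (_ : (fun u => _) = fun u => X u j i) // funeqE => u; rewrite mxE.
Qed.

Lemma constant_is_derive_mx m n (X : R -> 'M[R]_(m, n)) (s t : R) :
  (forall u : R, is_derive u 1 X 0) -> X s = X t.
Proof.
move=> dX; apply/matrixP => i j.
apply: (@constant_is_derive _ (fun u => X u i j)) => u _.
by have /is_derive_mxP/(_ i j) := dX u; rewrite mxE.
Qed.

(** Picard iteration.  If [W] acts on matrices with entrywise bound [B], the weight
    [expR (2 * B * `|t|)] makes the integral operator [step] a contraction of ratio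
    1/2 on all of [R].  The iterates therefore converge at a geometric rate, the limit
    is continuous, and it is a fixed point of [step]. *)
Lemma exists_fundamental_solution m (W : R -> 'M[R]_m) (b : R) :
  (forall i j, continuous (fun t => W t i j)) ->
  (forall t i j, `|W t i j| <= b) ->
  exists X : R -> 'M[R]_m, X 0 = 1%:M /\ forall t : R, is_derive t 1 X (W t *m X t).
Proof.
move=> Wc Wb0.
(* [b] can be negative when [m = 0]. *)
pose b' := Num.max b 0.
have Wb t i j : `|W t i j| <= b' by rewrite le_max Wb0.
have b0 : 0 <= b' by rewrite le_max lexx orbT.
have /choice [prim primP] : forall f : R -> R, exists F : R -> R,
    continuous f -> F 0 = 0 /\ forall t : R, is_derive t 1 F (f t).
  move=> f; have [fc|nfc] := pselect (continuous f).
    by have [F FE] := exists_primitive fc; exists F.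
  by exists (fun=> 0).
have contM (X : R -> 'M[R]_m) : (forall i j, continuous (fun t => X t i j)) ->
    forall i j, continuous (fun t => (W t *m X t) i j).
  move=> Xc i j.
  rewrite (_ : (fun u => _) = fun u => \sum_k W u i k * X u k j); last first.
    by rewrite funeqE => u; rewrite mxE.
  apply: continuous_big => [|k _ t]; first exact: add_continuous.
  by apply: cvgM; [apply: Wc|apply: Xc].
pose step (X : R -> 'M[R]_m) t : 'M[R]_m :=
  \matrix_(i, j) ((i == j)%:R + prim (fun u => (W u *m X u) i j) t).
have dstep (X : R -> 'M[R]_m) : (forall i j, continuous (fun t => X t i j)) ->
    forall t i j, is_derive t 1 (fun u => step X u i j) ((W t *m X t) i j).
  move=> Xc t i j.
  rewrite (_ : (fun u => _) =
    fun u => (i == j)%:R + prim (fun v => (W v *m X v) i j) u); last first.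
    by rewrite funeqE => u; rewrite mxE.
  have [_ H] := primP _ (contM _ Xc i j).
  rewrite -[X in is_derive _ _ _ X]add0r.
  by apply: is_deriveD; apply: is_derive_cst.
have step0 (X : R -> 'M[R]_m) : (forall i j, continuous (fun t => X t i j)) -> step X 0 = 1%:M.
  move=> Xc; apply/matrixP => i j; rewrite !mxE.
  by have [-> _] := primP _ (contM _ Xc i j); rewrite addr0.
have cstep (X : R -> 'M[R]_m) : (forall i j, continuous (fun t => X t i j)) ->
    forall i j, continuous (fun t => step X t i j).
  move=> Xc i j t; exact: is_derive_continuous (dstep _ Xc t i j).
pose B := m%:R * b' + 1.
have B0 : 0 < B by rewrite ltr_wpDl // mulr_ge0.
pose E (t : R) := expR (2 * B * `|t|).
have E0 t : 0 < E t by apply: expR_gt0.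
have Wbound (A : 'M[R]_m) t i j (a : R) : (forall i j, `|A i j| <= a) -> `|(W t *m A) i j| <= B * a.
  move=> Aa; have a0 : 0 <= a by apply: le_trans (Aa i j).
  rewrite mxE; apply: le_trans (ler_norm_sum _ _ _) _.
  apply: (@le_trans _ _ (\sum_(k < m) b' * a)).
    by apply: ler_sum => k _; rewrite normrM ler_pM.
  rewrite sumr_const card_ord -mulr_natl mulrA ler_wpM2r //.
  by rewrite /B lerDl.
have contract (X X' : R -> 'M[R]_m) a : (forall i j, continuous (fun t => X t i j)) ->
    (forall i j, continuous (fun t => X' t i j)) ->
    (forall t i j, `|X t i j - X' t i j| <= a * E t) ->
    forall t i j, `|step X t i j - step X' t i j| <= 2^-1 * a * E t.
  move=> Xc X'c XX t i j.
  have -> : 2^-1 * a = B * a / (2 * B) by field; rewrite gt_eqF.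
  apply: (@primitive_expR_bound _ (fun t => (W t *m X t) i j - (W t *m X' t) i j)
    (fun t => step X t i j - step X' t i j)).
  - by rewrite mulr_gt0.
  - by rewrite !step0 // subrr.
  - by move=> u; apply: is_deriveB; apply: dstep.
  - move=> u.
    have -> : (W u *m X u) i j - (W u *m X' u) i j = (W u *m (X u - X' u)) i j.
      by rewrite mulmxBr !mxE.
    by rewrite -mulrA; apply: Wbound => k l; rewrite !mxE; apply: XX.
pose Xs k := iter k step (fun=> 1%:M).
have cXs k : forall i j, continuous (fun t => Xs k t i j).
  elim: k => [|k IH] i j; last exact: cstep.
  exact: cst_continuous.
have dXs k t i j : `|Xs k.+1 t i j - Xs k t i j| <= 1 * E t * 2^-1 ^+ k.
  rewrite -mulrA [E t * _]mulrC mulrA.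
  elim: k t i j => [|k IH] t i j; last first.
    rewrite exprS mulrCA; exact: (contract (Xs k.+1) (Xs k) _ (cXs k.+1) (cXs k) IH).
  rewrite expr0 mul1r mul1r.
  apply: (@le_trans _ _ (B / (2 * B) * expR (2 * B * `|t|))); last first.
    have -> : B / (2 * B) = 2^-1 by field; rewrite gt_eqF.
    by rewrite ler_piMl ?(ltW (E0 t)) // invf_le1 ?ler1n.
  apply: (@primitive_expR_bound _ (fun t => (W t *m 1%:M) i j)
    (fun t => Xs 1 t i j - Xs 0 t i j)).
  - by rewrite mulr_gt0.
  - rewrite /Xs /= step0 ?subrr // => k l; exact: cst_continuous.
  - move=> u; rewrite -[X in is_derive _ _ _ X]subr0; apply: is_deriveB; last exact: is_derive_cst.
    by apply: dstep => k l; exact: cst_continuous.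
  - move=> u; apply: Wbound => k l.
    rewrite !mxE; apply: (@le_trans _ _ 1); first by case: eqP => _; rewrite ?normr1 ?normr0.
    by rewrite -expR0 ler_expR mulr_ge0 // mulr_ge0 // ltW.
have [X XE] : exists X : R -> 'M[R]_m, forall t i j k,
    `|Xs k t i j - X t i j| <= 2 * 2^-1 ^+ k * E t.
  have H t i j : exists l, forall k, `|Xs k t i j - l| <= 2 * 2^-1 ^+ k * E t.
    have [l [_ lE]] := cvg_geometric_increments (fun k => dXs k t i j).
    by exists l => k; apply: le_trans (lE k) _; rewrite mul1r mulrAC.
  exists (fun t => \matrix_(i, j) sval (cid (H t i j))) => t i j k.
  by rewrite mxE; case: cid.
have small (a e : R) : 0 < e -> exists k, a * 2^-1 ^+ k < e.
  move=> e0; have := @cvg_geometric R a 2^-1 _.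
  rewrite ger0_norm ?invr_ge0 // invf_lt1 ?ltr1n // => /(_ isT).
  move/cvgrPdist_lt => /(_ _ e0) [N _ /(_ N (leqnn _))] /=.
  by rewrite sub0r normrN => /(le_lt_trans (ler_norm _)) ?; exists N.
have Xc i j : continuous (fun t => X t i j).
  move=> t; apply/cvgrPdist_lt => e e0.
  have e30 : 0 < e / 3 by rewrite divr_gt0.
  have [k kE] := small (2 * expR (2 * B * (`|t| + 1))) _ e30.
  have near_bound u : `|u| <= `|t| + 1 -> `|Xs k u i j - X u i j| < e / 3.
    move=> ut; apply: le_lt_trans (XE _ _ _ _) (le_lt_trans _ kE).
    rewrite mulrAC ler_wpM2r ?exprn_ge0 ?invr_ge0 // ler_wpM2l //.
    by rewrite ler_expR ler_pM2l // mulr_gt0.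
  have kc : \forall u \near t, `|Xs k t i j - Xs k u i j| < e / 3.
    by have /cvgrPdist_lt := cXs k i j t; apply.
  near=> u.
  have ut : `|t - u| < 1 by near: u; apply: cvgr_dist_lt.
  have ut' : `|u| <= `|t| + 1.
    by rewrite -[u](subKr t) (le_trans (ler_normB _ _)) // lerD2l ltW.
  have := near_bound t _; have := near_bound u ut'; rewrite lerDl ler01 => h1 /(_ isT) h2.
  have h3 : `|Xs k t i j - Xs k u i j| < e / 3.
    by near: u.
  move: h1 h2 h3; rewrite !ltr_norml => /andP[? ?] /andP[? ?] /andP[? ?].
  apply/andP; split; lra.
exists X; suff XS t : X t = step X t.
  split=> [|t]; first by rewrite XS step0.
  apply/is_derive_mxP => i j; have := dstep X Xc t i j.
  by rewrite (_ : (fun u => X u i j) = fun u => step X u i j) // funeqE => u; rewrite XS.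
apply/matrixP => i j; apply/eqP; rewrite -subr_eq0 -normr_eq0 eq_le normr_ge0 andbT.
apply/ler_addgt0Pl => e e0; rewrite addr0.
have [k kE] := small (2 * E t) _ e0.
have h1 := XE t i j k.+1.
have h2 : `|step (Xs k) t i j - step X t i j| <= 2^-1 * (2 * 2^-1 ^+ k) * E t.
  exact: (contract (Xs k) X _ (cXs k) Xc (fun t i j => XE t i j k)).
have -> : X t i j - step X t i j = (step (Xs k) t i j - step X t i j) - (Xs k.+1 t i j - X t i j).
  rewrite -[Xs k.+1 t i j]/(step (Xs k) t i j); ring.
apply: le_trans (ler_normB _ _) _; apply: le_trans (lerD h2 h1) _.
apply: le_trans _ (ltW kE); rewrite exprS le_eqVlt; apply/orP; left; apply/eqP.
by field.
Unshelve. all: by end_near.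
Qed.

Definition fundamental_pair m (W X Y : R -> 'M[R]_m) : Prop :=
  [/\ forall t, is_derive t 1 X (W t *m X t),
      forall t, is_derive t 1 Y (- (Y t *m W t)),
      forall t, Y t *m X t = 1%:M & X 0 = 1%:M].

(** [Y] is the transposed fundamental solution of the adjoint equation; [Y *m X] has
    derivative zero, so the inverse of [X] is obtained without determinants. *)
Lemma exists_fundamental_pair m (W : R -> 'M[R]_m) (b : R) :
  (forall i j, continuous (fun t => W t i j)) ->
  (forall t i j, `|W t i j| <= b) ->
  exists X Y : R -> 'M[R]_m, fundamental_pair W X Y.
Proof.
move=> Wc Wb.
have [X [X0 dX]] := exists_fundamental_solution Wc Wb.
have [||Z [Z0 dZ]] := @exists_fundamental_solution m (fun t => - (W t)^T) b.
- move=> i j; rewrite (_ : (fun t => _) = fun t => - W t j i).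
    by move=> t; apply: cvgN; apply: Wc.
  by rewrite funeqE => t; rewrite !mxE.
- by move=> t i j; rewrite !mxE normrN.
exists X, (fun t => (Z t)^T).
have dY (t : R) : is_derive t 1 (fun t => (Z t)^T) (- ((Z t)^T *m W t)).
  have := is_derive_trmx (dZ t).
  by rewrite mulNmx linearN /= trmx_mul trmxK.
split=> // t.
have -> : (Z t)^T *m X t = (Z 0)^T *m X 0; last by rewrite Z0 X0 trmx1 mul1mx.
apply: (@constant_is_derive_mx m m (fun u => (Z u)^T *m X u)) => u.
have := is_derive_mulmx (dY u) (dX u).
by rewrite mulNmx mulmxA addNr.
Qed.

(** Uniqueness: [Y t *m T t s] does not depend on [t]. *)
Lemma evolution_operator_fundamental m (W : R -> 'M[R]_m) (X Y : R -> 'M[R]_m)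
    (T : R -> R -> 'M[R]_m) :
  (forall t : R, is_derive t 1 Y (- (Y t *m W t))) ->
  (forall t, Y t *m X t = 1%:M) ->
  evolution_operator W T -> forall t s, T t s = X t *m Y s.
Proof.
move=> dY YX [T1 dT] t s.
have YT : Y t *m T t s = Y s.
  rewrite -[RHS]mulmx1 -[in RHS](T1 s).
  apply: (@constant_is_derive_mx m m (fun u => Y u *m T u s)) => u.
  have := is_derive_mulmx (dY u) (dT u s).
  by rewrite mulNmx mulmxA addNr.
by rewrite -YT mulmxA (mulmx1C (YX t)) mul1mx.
Qed.

Lemma fundamental_evolution_operator m (W : R -> 'M[R]_m) (X Y : R -> 'M[R]_m) :
  (forall t : R, is_derive t 1 X (W t *m X t)) ->
  (forall t, Y t *m X t = 1%:M) ->
  evolution_operator W (fun t s => X t *m Y s).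
Proof.
move=> dX YX; split=> [s|t s]; first exact: mulmx1C.
by rewrite mulmxA; apply: is_derive_mulmxr.
Qed.

End MatrixCalculus.

(** * Euclidean norm, Gronwall and mean value inequalities *)

Section Norms.
Variable R : realType.

Definition form m (A : 'M[R]_m) (x y : 'cV[R]_m) : R := (x^T *m A *m y) 0 0.

Definition dot m (x y : 'cV[R]_m) : R := (x^T *m y) 0 0.

Lemma form1 m (x y : 'cV[R]_m) : form 1%:M x y = dot x y.
Proof. by rewrite /form mulmx1. Qed.

Lemma dotE m (x y : 'cV[R]_m) : dot x y = \sum_i x i 0 * y i 0.
Proof. by rewrite /dot mxE; apply: eq_bigr => i _; rewrite mxE. Qed.

Lemma dot_sqr m (x : 'cV[R]_m) : dot x x = \sum_i x i 0 ^+ 2.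
Proof. by rewrite dotE; apply: eq_bigr => i _; rewrite expr2. Qed.

Lemma dot_ge0 m (x : 'cV[R]_m) : 0 <= dot x x.
Proof. by rewrite dot_sqr sumr_ge0 // => i _; rewrite sqr_ge0. Qed.

Lemma dotC m (x y : 'cV[R]_m) : dot x y = dot y x.
Proof. by rewrite !dotE; apply: eq_bigr => i _; rewrite mulrC. Qed.

Lemma dotDr m (x y z : 'cV[R]_m) : dot x (y + z) = dot x y + dot x z.
Proof. by rewrite /dot mulmxDr mxE. Qed.

Lemma dotDl m (x y z : 'cV[R]_m) : dot (y + z) x = dot y x + dot z x.
Proof. by rewrite !(dotC _ x) dotDr. Qed.

Lemma dotZr m (a : R) (x y : 'cV[R]_m) : dot x (a *: y) = a * dot x y.
Proof. by rewrite /dot -scalemxAr mxE. Qed.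

Lemma dotZl m (a : R) (x y : 'cV[R]_m) : dot (a *: y) x = a * dot y x.
Proof. by rewrite !(dotC _ x) dotZr. Qed.

Lemma dotNr m (x y : 'cV[R]_m) : dot x (- y) = - dot x y.
Proof. by rewrite -scaleN1r dotZr mulN1r. Qed.

Lemma dotBr m (x y z : 'cV[R]_m) : dot x (y - z) = dot x y - dot x z.
Proof. by rewrite dotDr dotNr. Qed.

Lemma dot0r m (x : 'cV[R]_m) : dot x 0 = 0.
Proof. by rewrite /dot mulmx0 mxE. Qed.

Lemma dot_mulmxl m n (A : 'M[R]_(m, n)) (x : 'cV[R]_n) (y : 'cV[R]_m) :
  dot (A *m x) y = dot x (A^T *m y).
Proof. by rewrite /dot trmx_mul mulmxA. Qed.

Lemma dot_eq0 m (x : 'cV[R]_m) : dot x x = 0 -> x = 0.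
Proof.
move/eqP; rewrite dot_sqr psumr_eq0 => [/allP H|i _]; last exact: sqr_ge0.
apply/matrixP => i j; rewrite ord1 mxE; apply/eqP.
by have := H i (mem_index_enum _); rewrite sqrf_eq0.
Qed.

Lemma form_dot m (A : 'M[R]_m) x y : form A x y = dot x (A *m y).
Proof. by rewrite /form /dot mulmxA. Qed.

(** The Euclidean product is the case [A = 1%:M]; a positive definite [A] yields its own
    coercivity, see [posdef_coercive]. *)
Lemma form_cauchy_schwarz m (A : 'M[R]_m) (x y : 'cV[R]_m) :
  A^T = A -> (forall z, 0 <= form A z z) ->
  form A x y ^+ 2 <= form A x x * form A y y.
Proof.
move=> At Ap.
have fC : form A y x = form A x y by rewrite !form_dot dotC dot_mulmxl At.
have fE s : form A (x - s *: y) (x - s *: y) =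
    form A x x - 2 * s * form A x y + s ^+ 2 * form A y y.
  rewrite !form_dot mulmxBr -scalemxAr !dotBr -scaleNr !dotDl !dotZl !dotZr -!form_dot fC.
  by ring.
have [q0|qpos] := eqVneq (form A y y) 0; last first.
  have qp : 0 < form A y y by rewrite lt_def qpos Ap.
  have := Ap (x - (form A x y / form A y y) *: y); rewrite fE.
  set p := form A x x; set q := form A y y; set r := form A x y.
  have -> : p - 2 * (r / q) * r + (r / q) ^+ 2 * q = (p * q - r ^+ 2) / q.
    by field; rewrite gt_eqF.
  by rewrite pmulr_lge0 ?invr_gt0 // subr_ge0.
suff -> : form A x y = 0 by rewrite q0 mulr0 expr0n.
apply/eqP; apply: contraT => r0.
have := Ap (x - ((form A x x + 1) / (2 * form A x y)) *: y).
rewrite fE q0 mulr0 addr0.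
suff -> : 2 * ((form A x x + 1) / (2 * form A x y)) * form A x y = form A x x + 1.
  by rewrite opprD addrA subrr sub0r ler0N1.
by field.
Qed.

Lemma enormE m (x : 'cV[R]_m) : enorm x = Num.sqrt (dot x x).
Proof. by rewrite /enorm dot_sqr. Qed.

Lemma enorm_ge0 m (x : 'cV[R]_m) : 0 <= enorm x.
Proof. exact: sqrtr_ge0. Qed.

Lemma sqr_enorm m (x : 'cV[R]_m) : enorm x ^+ 2 = dot x x.
Proof. by rewrite enormE sqr_sqrtr // dot_ge0. Qed.

Lemma enorm0 m : enorm (0 : 'cV[R]_m) = 0.
Proof. by rewrite enormE dot0r sqrtr0. Qed.

Lemma enorm_eq0 m (x : 'cV[R]_m) : enorm x = 0 -> x = 0.
Proof. by move=> x0; apply: dot_eq0; rewrite -sqr_enorm x0 expr0n. Qed.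

Lemma enormZ m (a : R) (x : 'cV[R]_m) : enorm (a *: x) = `|a| * enorm x.
Proof.
rewrite !enormE dotZl dotZr mulrA -expr2 sqrtrM ?sqr_ge0 //.
by rewrite sqrtr_sqr.
Qed.

Lemma enormN m (x : 'cV[R]_m) : enorm (- x) = enorm x.
Proof. by rewrite -scaleN1r enormZ normrN1 mul1r. Qed.

Lemma enorm_le m n (x : 'cV[R]_m) (y : 'cV[R]_n) (K : R) : 0 <= K ->
  (enorm x <= K * enorm y) = (dot x x <= K ^+ 2 * dot y y).
Proof.
move=> K0; rewrite -!sqr_enorm -exprMn ler_pXn2r // nnegrE ?enorm_ge0 //.
by rewrite mulr_ge0 // enorm_ge0.
Qed.

Lemma sqr_dot_le m (x y : 'cV[R]_m) : dot x y ^+ 2 <= dot x x * dot y y.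
Proof.
rewrite -!form1.
by apply: form_cauchy_schwarz => [|z]; rewrite ?trmx1 // form1 dot_ge0.
Qed.

Lemma cauchy_schwarz m (x y : 'cV[R]_m) : `|dot x y| <= enorm x * enorm y.
Proof.
rewrite -(@ler_pXn2r _ 2) // ?nnegrE ?mulr_ge0 ?enorm_ge0 //.
by rewrite exprMn !sqr_enorm real_normK ?num_real // sqr_dot_le.
Qed.

Lemma dot_le m (x y : 'cV[R]_m) : dot x y <= enorm x * enorm y.
Proof. exact: le_trans (ler_norm _) (cauchy_schwarz x y). Qed.

Lemma enormD m (x y : 'cV[R]_m) : enorm (x + y) <= enorm x + enorm y.
Proof.
rewrite -(@ler_pXn2r _ 2) // ?nnegrE ?addr_ge0 ?enorm_ge0 //.
rewrite sqr_enorm sqrrD !sqr_enorm dotDl !dotDr (dotC y x).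
by have := dot_le x y; lra.
Qed.

Lemma enormB m (x y : 'cV[R]_m) : enorm (x - y) <= enorm x + enorm y.
Proof. by rewrite -[in leRHS](enormN y) enormD. Qed.

Lemma enorm_entry m (x : 'cV[R]_m) i : `|x i 0| <= enorm x.
Proof.
rewrite -(@ler_pXn2r _ 2) // ?nnegrE ?enorm_ge0 // real_normK ?num_real //.
rewrite sqr_enorm dot_sqr (bigD1 i) //= lerDl sumr_ge0 // => j _.
exact: sqr_ge0.
Qed.

Lemma exists_mulmx_bound m n (A : 'M[R]_(m, n)) :
  exists2 K, 0 <= K & forall x, enorm (A *m x) <= K * enorm x.
Proof.
pose F := \sum_i enorm (row i A)^T ^+ 2.
have F0 : 0 <= F by apply: sumr_ge0 => i _; rewrite sqr_ge0.
exists (Num.sqrt F) => [|x]; first exact: sqrtr_ge0.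
rewrite enorm_le ?sqrtr_ge0 // sqr_sqrtr // dot_sqr mulr_suml.
apply: ler_sum => i _.
have -> : (A *m x) i 0 = dot (row i A)^T x.
  by rewrite /dot trmxK -row_mul [RHS]mxE.
rewrite -sqr_enorm -exprMn -[in leLHS]real_normK ?num_real //.
by rewrite ler_pXn2r ?nnegrE ?mulr_ge0 ?enorm_ge0 // cauchy_schwarz.
Qed.

Lemma enorm_mulmx_entry m n (A : 'M[R]_(m, n)) K :
  (forall x, enorm (A *m x) <= K * enorm x) -> forall i j, `|A i j| <= K.
Proof.
move=> AK i j; have := AK (delta_mx j 0).
have -> : enorm (delta_mx j 0 : 'cV[R]_n) = 1.
  rewrite enormE dot_sqr (bigD1 j) //= mxE !eqxx expr1n big1 ?addr0 ?sqrtr1 //.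
  by move=> k kj; rewrite mxE (negbTE kj) expr0n.
rewrite mulr1; apply: le_trans.
have -> : A i j = col j A i 0 by rewrite mxE.
by rewrite -colE; apply: enorm_entry.
Qed.

Lemma opnorm_le m (A : 'M[R]_m) K : 0 <= K ->
  (forall x, enorm (A *m x) <= K * enorm x) -> opnorm A <= K.
Proof.
move=> K0 AK; apply: ge_sup.
  by exists 0, 0; rewrite /= ?mulmx0 enorm0.
move=> _ [x /= x1 <-]; apply: le_trans (AK x) _.
by rewrite ler_piMr.
Qed.

Lemma enorm_mulmx m (A : 'M[R]_m) x : enorm (A *m x) <= opnorm A * enorm x.
Proof.
have [x0|xn0] := eqVneq (enorm x) 0.
  by rewrite (enorm_eq0 x0) mulmx0 !enorm0 mulr0.
have xp : 0 < enorm x by rewrite lt_def xn0 enorm_ge0.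
have [K K0 AK] := exists_mulmx_bound A.
have : enorm (A *m ((enorm x)^-1 *: x)) <= opnorm A.
  apply: ub_le_sup.
    exists K => _ [y /= y1 <-]; apply: le_trans (AK y) _.
    by rewrite ler_piMr.
  exists ((enorm x)^-1 *: x) => //=.
  by rewrite enormZ ger0_norm ?invr_ge0 ?enorm_ge0 // mulVf.
rewrite -scalemxAr enormZ ger0_norm ?invr_ge0 ?enorm_ge0 //.
by rewrite ler_pdivrMl // mulrC.
Qed.

Lemma opnorm_ge0 m (A : 'M[R]_m) : 0 <= opnorm A.
Proof.
have [K K0 AK] := exists_mulmx_bound A.
apply: (@le_trans _ _ (enorm (A *m 0))); first exact: enorm_ge0.
apply: ub_le_sup; last by exists 0; rewrite /= ?enorm0.
exists K => _ [y /= y1 <-]; apply: le_trans (AK y) _.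
by rewrite ler_piMr.
Qed.

Lemma is_derive_dot m (x y : R -> 'cV[R]_m) dx dy (t : R) :
  is_derive t 1 x dx -> is_derive t 1 y dy ->
  is_derive t 1 (fun u => dot (x u) (y u)) (dot dx (y t) + dot (x t) dy).
Proof.
move=> Dx Dy.
have /is_derive_mxP /(_ 0 0) := is_derive_mulmx (is_derive_trmx Dx) Dy.
by rewrite mxE.
Qed.

Lemma is_derive_dot_sqr m (x : R -> 'cV[R]_m) dx (t : R) :
  is_derive t 1 x dx ->
  is_derive t 1 (fun u => dot (x u) (x u)) (2 * dot (x t) dx).
Proof.
move=> Dx; have -> : 2 * dot (x t) dx = dot dx (x t) + dot (x t) dx.
  by rewrite (dotC dx); ring.
exact: is_derive_dot.
Qed.

Lemma gronwall (f df : R -> R) (k s t : R) : s <= t ->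
  (forall u : R, is_derive u 1 f (df u)) ->
  (forall u, s < u < t -> df u <= k * f u) ->
  f t <= expR (k * (t - s)) * f s.
Proof.
move=> st fE fk.
have H : 1 * expR (- k * t) * f t <= 1 * expR (- k * s) * f s.
  apply: (@nonincreasing_is_derive R (fun u => 1 * expR (- k * u) * f u)
    (fun u => 1 * (- k * expR (- k * u)) * f u + 1 * expR (- k * u) * df u) _ _ st).
    by move=> u _; apply: is_derive_mulf; first exact: is_derive_expRM.
  move=> u /fk H.
  have -> : 1 * (- k * expR (- k * u)) * f u + 1 * expR (- k * u) * df u
      = expR (- k * u) * (df u - k * f u) by ring.
  by rewrite mulr_ge0_le0 ?expR_ge0 // subr_le0.
have -> : f t = expR (k * t) * (1 * expR (- k * t) * f t).
  by rewrite mul1r mulrA -expRD mulNr subrr expR0 mul1r.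
have -> : k * (t - s) = k * t + - k * s by ring.
by rewrite expRD -[leRHS]mulrA ler_wpM2l ?expR_ge0 // -[expR (- k * s)]mul1r.
Qed.

(** The scalar mean value inequality, applied to the component of [g] along the
    increment [g t - g s]. *)
Lemma mean_value_enorm m (g dg : R -> 'cV[R]_m) (B s t : R) : s <= t ->
  (forall u : R, is_derive u 1 g (dg u)) ->
  (forall u, s < u < t -> enorm (dg u) <= B) ->
  enorm (g t - g s) <= B * (t - s).
Proof.
move=> st gE gB.
have [d0|dn0] := eqVneq (enorm (g t - g s)) 0.
  rewrite d0; move: st; rewrite le_eqVlt => /predU1P[->|st]; first by rewrite subrr mulr0.
  apply: mulr_ge0; last by rewrite subr_ge0 ltW.
  apply: le_trans (enorm_ge0 (dg ((s + t) / 2))) _.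
  by apply: gB; rewrite !midf_lt.
set d := g t - g s in dn0 *.
have dp : 0 < enorm d by rewrite lt_def dn0 enorm_ge0.
have := @nonincreasing_is_derive _ (fun u => dot d (g u) - B * enorm d * u)
  (fun u => dot d (dg u) - B * enorm d) s t st.
have -> : (dot d (g t) - B * enorm d * t <= dot d (g s) - B * enorm d * s)
    = (enorm d * enorm d <= enorm d * (B * (t - s))).
  rewrite -expr2 sqr_enorm {4}/d dotBr -subr_ge0 -[RHS]subr_ge0.
  by congr (0 <= _); ring.
rewrite ler_pM2l //; apply.
  move=> u _; apply: is_deriveB.
    have := is_derive_dot (is_derive_mx_cst d u) (gE u).
    by rewrite dotC dot0r add0r.
  have : is_derive u 1 ((B * enorm d) \*: @id R) ((B * enorm d) *: 1) by apply: is_deriveZ.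
  by rewrite /GRing.scale/= mulr1.
move=> u /gB gu; rewrite subr_le0; apply: le_trans (dot_le _ _) _.
by rewrite mulrC ler_wpM2r // enorm_ge0.
Qed.

End Norms.

(** * Discrete dichotomies from invariant cones *)

Section EntrywiseLimits.
Variable R : realType.

Definition entrywise_cvg m n (A : nat -> 'M[R]_(m, n)) (B : 'M[R]_(m, n)) : Prop :=
  forall i j, A k i j @[k --> \oo] --> B i j.

Lemma entrywise_cvg_mulmx m n p (A : nat -> 'M[R]_(m, n)) B
    (A' : nat -> 'M[R]_(n, p)) B' :
  entrywise_cvg A B -> entrywise_cvg A' B' ->
  entrywise_cvg (fun k => A k *m A' k) (B *m B').
Proof.
move=> AB AB' i j; rewrite mxE.
rewrite (_ : (fun k => _) = fun k => \sum_l A k i l * A' k l j); last first.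
  by rewrite funeqE => k; rewrite mxE.
apply: cvg_big => [|l _]; first exact: add_continuous.
by apply: cvgM; [apply: AB|apply: AB'].
Qed.

Lemma entrywise_cvg_cst m n (A : 'M[R]_(m, n)) : entrywise_cvg (fun=> A) A.
Proof. by move=> i j; apply: cvg_cst. Qed.

Lemma entrywise_cvg_unique m n (A : nat -> 'M[R]_(m, n)) B C :
  entrywise_cvg A B -> entrywise_cvg A C -> B = C.
Proof.
move=> AB AC; apply/matrixP => i j.
by rewrite -(cvg_lim (@Rhausdorff R) (AB i j)) -(cvg_lim (@Rhausdorff R) (AC i j)).
Qed.

Lemma cvg_dot m (x y : nat -> 'cV[R]_m) x' y' :
  entrywise_cvg x x' -> entrywise_cvg y y' ->
  dot (x k) (y k) @[k --> \oo] --> dot x' y'.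
Proof.
move=> xx' yy'; apply: (entrywise_cvg_mulmx (A := fun k => (x k)^T)) => // i j.
rewrite mxE (_ : (fun k => _) = fun k => x k j i); last by rewrite funeqE => k; rewrite mxE.
exact: xx'.
Qed.

End EntrywiseLimits.

(** [a k v] and [b k v] are the squared norms of the two components, in [im Pi] and
    in [ker Pi], at step [k] of the orbit of [v].  The hypotheses [contraction] and
    [expansion] make the cone [a <= b] forward invariant with [b] growing, and the
    cone [b <= a] backward invariant with [a] decaying. *)
Section DiscreteDichotomy.
Variables (R : realType) (m : nat) (Pi : 'M[R]_m) (Z Zi : nat -> 'M[R]_m).
Hypotheses (PiT : Pi^T = Pi) (PiPi : Pi *m Pi = Pi).
Hypotheses (ZiZ : forall k, Zi k *m Z k = 1%:M) (Z0 : Z 0 = 1%:M).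

Let Pc : 'M[R]_m := 1%:M - Pi.
Let a k (v : 'cV[R]_m) := dot (Pi *m (Z k *m v)) (Pi *m (Z k *m v)).
Let b k (v : 'cV[R]_m) := dot (Pc *m (Z k *m v)) (Pc *m (Z k *m v)).

Hypothesis contraction : forall k v, 16 * a k.+1 v <= 2 * a k v + b k v.
Hypothesis expansion : forall k v, 15 * b k v <= b k.+1 v + a k v.

Let a0 k v : 0 <= a k v. Proof. exact: dot_ge0. Qed.
Let b0 k v : 0 <= b k v. Proof. exact: dot_ge0. Qed.

Let PiPc : Pi *m Pc = 0.
Proof. by rewrite mulmxBr mulmx1 PiPi subrr. Qed.

Lemma dot_projection (x : 'cV[R]_m) :
  dot x x = dot (Pi *m x) (Pi *m x) + dot (Pc *m x) (Pc *m x).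
Proof.
have orth : dot (Pi *m x) (Pc *m x) = 0.
  by rewrite dot_mulmxl PiT mulmxA PiPc mul0mx dot0r.
have {1 2}-> : x = Pi *m x + Pc *m x by rewrite -mulmxDl addrC subrK mul1mx.
by rewrite dotDl !dotDr orth (dotC _ (Pi *m x)) orth addr0 add0r.
Qed.

Let dot_Z k v : dot (Z k *m v) (Z k *m v) = a k v + b k v.
Proof. exact: dot_projection. Qed.

Let unstable_step k v : a k v <= b k v -> 14 * b k v <= b k.+1 v /\ 4 * a k.+1 v <= b k.+1 v.
Proof.
move=> ab; have := contraction k v; have := expansion k v.
move: (a0 k v) (b0 k v) (a0 k.+1 v) (b0 k.+1 v) => h1 h2 h3 h4 h5 h6.
by split; lra.
Qed.

Let stable_step k v : b k.+1 v <= a k.+1 v -> 4 * b k v <= a k v /\ 4 * a k.+1 v <= a k v.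
Proof.
move=> ba; have := contraction k v; have := expansion k v.
move: (a0 k v) (b0 k v) (a0 k.+1 v) (b0 k.+1 v) => h1 h2 h3 h4 h5 h6.
by split; lra.
Qed.

Let unstable_iter v j k : a j v <= b j v ->
  a (j + k) v <= b (j + k) v /\ 14 ^+ k * b j v <= b (j + k) v.
Proof.
move=> ab; elim: k => [|k [IHa IHb]]; first by rewrite addn0 expr0 mul1r.
rewrite addnS exprS -mulrA; have [h1 h2] := unstable_step IHa.
have := a0 (j + k).+1 v => h3; split; lra.
Qed.

Let stable_iter v j k : b (j + k) v <= a (j + k) v ->
  b j v <= a j v /\ 4 ^+ k * a (j + k) v <= a j v.
Proof.
elim: k => [|k IH]; first by rewrite addn0 expr0 mul1r.
rewrite addnS => /stable_step [h1 h2]; have [|h3 h4] := IH.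
  by move: (b0 (j + k) v); lra.
split=> //; apply: le_trans h4; by rewrite exprSr -mulrA ler_wpM2l.
Qed.

Let a_at0 v : a 0 v = dot (Pi *m v) (Pi *m v).
Proof. by rewrite /a Z0 mul1mx. Qed.

Let b_at0 v : b 0 v = dot (Pc *m v) (Pc *m v).
Proof. by rewrite /b Z0 mul1mx. Qed.

Let stable_injective k v : b k v = 0 -> Pi *m v = 0 -> v = 0.
Proof.
move=> bk Piv; have [|h _] := @stable_iter v 0 k; first by rewrite add0n bk.
apply: dot_eq0; rewrite dot_projection -b_at0 Piv dot0r add0r.
by apply/eqP; rewrite eq_le b0 andbT (le_trans h) // a_at0 Piv dot0r.
Qed.

(** The initial data whose orbit lies in [im Pi] at step [k] form a subspace of the
    dimension of [im Pi].  By [stable_injective] it meets [ker Pi] trivially, so it is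
    a graph over [im Pi], and [P] is the projection on this graph along [ker Pi]. *)
Let finite_horizon_projection k : exists P : 'M[R]_m,
  [/\ Pi *m P = Pi, P *m Pi = P & forall v, b k (P *m v) <= a k (P *m v)].
Proof.
(* [G] is [Pi *m Zi k] on [im Pi], completed by the identity on [ker Pi]. *)
pose G := Pi *m Zi k *m Pi + Pc.
have PiG : Pi *m G = Pi *m Zi k *m Pi.
  by rewrite mulmxDr PiPc addr0 !mulmxA PiPi.
have ZZi : Z k *m Zi k = 1%:M by apply: mulmx1C.
have Gu : G \in unitmx.
  rewrite -unitmx_tr -row_free_unit -kermx_eq0; apply/eqP/row_matrixP => i.
  rewrite row0; set r := row i _.
  have : G *m r^T = 0.
    apply: trmx_inj; rewrite trmx_mul trmxK trmx0.
    by apply/eqP; rewrite -sub_kermx row_sub.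
  move: r^T (trmxK r) => u <- Gu0.
  suff -> : u = 0 by rewrite trmx0.
  have h1 : Pi *m (Zi k *m (Pi *m u)) = 0.
    by have := congr1 (mulmx Pi) Gu0; rewrite mulmxA PiG mulmx0 -!mulmxA.
  have h2 : Pc *m u = 0 by move: Gu0; rewrite mulmxDl -!mulmxA h1 add0r.
  have h3 : Zi k *m (Pi *m u) = 0.
    apply: (@stable_injective k) h1.
    by rewrite /b [Z k *m _]mulmxA ZZi mul1mx mulmxA mulmxBl mul1mx PiPi subrr mul0mx dot0r.
  have h4 : Pi *m u = 0 by rewrite -[LHS]mul1mx -ZZi -mulmxA h3 mulmx0.
  by rewrite -[u]mul1mx -(subrK Pi 1%:M) mulmxDl h4 h2 addr0.
pose P := Zi k *m Pi *m invmx G *m Pi.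
exists P; split.
- have -> : Pi *m P = Pi *m G *m invmx G *m Pi by rewrite PiG /P !mulmxA.
  by rewrite mulmxK.
- by rewrite /P -mulmxA PiPi.
- move=> v; suff -> : b k (P *m v) = 0 by apply: a0.
  rewrite /b /P -!mulmxA [Z k *m _]mulmxA ZZi mul1mx [Pc *m _]mulmxA.
  by rewrite mulmxBl mul1mx PiPi subrr mul0mx dot0r.
Qed.

(** For given [v], the finite-horizon projections [Ps k *m v] and [Ps k.+1 *m v] differ
    by a vector of [ker Pi], whose orbit grows at least like [14 ^+ k] (squared norms),
    while up to step [k] both orbits stay in the cone [b <= a] and decay like
    [4 ^- k].  Hence the [Ps k] converge geometrically. *)
Lemma exists_stable_projection : exists P : 'M[R]_m,
  [/\ Pi *m P = Pi, P *m Pi = P & forall k v, b k (P *m v) <= a k (P *m v)].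
Proof.
have /choice [Ps PsE] := finite_horizon_projection.
have PsS k j v : (j <= k)%N -> b j (Ps k *m v) <= a j (Ps k *m v).
  move=> jk; have [_ _ /(_ v)] := PsE k.
  by move=> h; have [|//] := @stable_iter (Ps k *m v) j (k - j); rewrite subnKC.
have Psa k v : 4 ^+ k * a k (Ps k *m v) <= dot v v.
  have [PiP _ h] := PsE k; have [|_] := @stable_iter (Ps k *m v) 0 k; rewrite add0n //.
  move=> /le_trans; apply.
  rewrite a_at0 mulmxA PiP [leRHS]dot_projection lerDl; exact: dot_ge0.
have Psa' k v : 4 ^+ k * a k (Ps k.+1 *m v) <= dot v v.
  have [PiP _ _] := PsE k.+1.
  have h := PsS k.+1 k v (leqnSn _).
  have [|_] := @stable_iter (Ps k.+1 *m v) 0 k; rewrite add0n //.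
  move=> /le_trans; apply.
  rewrite a_at0 mulmxA PiP [leRHS]dot_projection lerDl; exact: dot_ge0.
have step k v : enorm ((Ps k.+1 - Ps k) *m v) <= 2 * 2^-1 ^+ k * enorm v.
  rewrite enorm_le ?mulr_ge0 ?exprn_ge0 ?invr_ge0 //.
  set q := _ *m v.
  have Piq : Pi *m q = 0.
    have [PiP _ _] := PsE k; have [PiP' _ _] := PsE k.+1.
    by rewrite /q mulmxA mulmxBr PiP PiP' subrr mul0mx.
  have aq : a 0 q = 0 by rewrite a_at0 Piq dot0r.
  have -> : dot q q = b 0 q by rewrite dot_projection Piq dot0r add0r b_at0.
  have [|_] := @unstable_iter q 0 k; first by rewrite aq.
  rewrite add0n => bq.
  have bsplit : b k q <= 2 * (b k (Ps k.+1 *m v) + b k (Ps k *m v)).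
    have -> : q = Ps k.+1 *m v - Ps k *m v by rewrite /q mulmxBl.
    rewrite /b [Z k *m (_ - _)]mulmxBr [Pc *m (_ - _)]mulmxBr.
    set x := Pc *m (Z k *m (Ps k.+1 *m v)); set y := Pc *m (Z k *m (Ps k *m v)).
    have := dot_ge0 (x + y).
    rewrite dotBr !dotDl -scaleN1r !dotZl !dotDr (dotC y x); lra.
  have h1 := PsS k.+1 k v (leqnSn _); have h2 := PsS k k v (leqnn _).
  have h3 := Psa k v; have h4 := Psa' k v.
  have p4 : 0 < (4 ^+ k : R) by rewrite exprn_gt0.
  have -> : (2 * 2^-1 ^+ k) ^+ 2 * dot v v = 4 * dot v v / 4 ^+ k.
    rewrite exprMn -exprM mulnC exprM [2^-1 ^+ 2]exprVn exprVn.
    have -> : 2 ^+ 2 = 4 :> R by rewrite expr2; ring.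
    by rewrite mulrAC.
  rewrite ler_pdivlMr //.
  have p14 : b 0 q <= 14 ^+ k * b 0 q.
    by rewrite ler_peMl ?b0 // exprn_ege1 // ler1n.
  have hh : b 0 q <= 2 * (a k (Ps k.+1 *m v) + a k (Ps k *m v)) by lra.
  rewrite mulrC; apply: le_trans (ler_wpM2l (ltW p4) hh) _.
  by rewrite mulrCA mulrDr; lra.
have entry k i j : `|Ps k.+1 i j - Ps k i j| <= 2 * 2^-1 ^+ k.
  by have := enorm_mulmx_entry (step k) i j; rewrite !mxE.
pose P := \matrix_(i, j) sval (cid (cvg_geometric_increments (fun k => entry k i j))).
have PsP : entrywise_cvg Ps P.
  by move=> i j; rewrite mxE; case: cid => l [].
exists P; split.
- apply: (@entrywise_cvg_unique _ _ _ (fun k => Pi *m Ps k)).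
    by apply: entrywise_cvg_mulmx => //; apply: entrywise_cvg_cst.
  rewrite (_ : (fun k => _) = fun=> Pi); first exact: entrywise_cvg_cst.
  by rewrite funeqE => k; case: (PsE k).
- apply: (@entrywise_cvg_unique _ _ _ (fun k => Ps k *m Pi)).
    by apply: entrywise_cvg_mulmx => //; apply: entrywise_cvg_cst.
  rewrite (_ : (fun k => _) = Ps) // funeqE => k; by case: (PsE k).
- move=> k v.
  have cvgf (A : 'M[R]_m) : dot (A *m (Z k *m (Ps j *m v))) (A *m (Z k *m (Ps j *m v))) @[j --> \oo]
      --> dot (A *m (Z k *m (P *m v))) (A *m (Z k *m (P *m v))).
    have c : entrywise_cvg (fun j => A *m (Z k *m (Ps j *m v))) (A *m (Z k *m (P *m v))).
      do 2 (apply: entrywise_cvg_mulmx; first exact: entrywise_cvg_cst).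
      by apply: entrywise_cvg_mulmx => //; apply: entrywise_cvg_cst.
    exact: cvg_dot.
  have c : b k (Ps j *m v) - a k (Ps j *m v) @[j --> \oo] --> b k (P *m v) - a k (P *m v).
    by apply: cvgB; apply: cvgf.
  rewrite -subr_le0; apply: (cvgr_to_le c).
  exists k => // j /= kj; rewrite subr_le0; exact: PsS.
Qed.

Variable P : 'M[R]_m.
Hypotheses (PiP : Pi *m P = Pi) (PPi : P *m Pi = P).
Hypothesis stableP : forall k v, b k (P *m v) <= a k (P *m v).

Lemma stable_projection_idempotent : P *m P = P.
Proof. by rewrite -{1}PPi -mulmxA PiP. Qed.

Lemma rank_stable_projection : \rank P = \rank Pi.
Proof.
apply/eqP; rewrite eqn_leq; apply/andP; split.
  by rewrite -PPi mxrankM_maxr.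
by rewrite -PiP mxrankM_maxr.
Qed.

Lemma stable_decay j k v :
  enorm (Z (j + k) *m (P *m v)) <= 2 * 2^-1 ^+ k * enorm (Z j *m (P *m v)).
Proof.
rewrite enorm_le ?mulr_ge0 ?exprn_ge0 ?invr_ge0 //.
have -> : (2 * 2^-1 ^+ k) ^+ 2 = 4 / 4 ^+ k :> R.
  rewrite exprMn -exprM mulnC exprM [2^-1 ^+ 2]exprVn exprVn.
  by have -> : 2 ^+ 2 = 4 :> R by rewrite expr2; ring.
rewrite mulrAC ler_pdivlMr ?exprn_gt0 // mulrC !dot_Z.
have [_ h] := stable_iter (stableP (j + k) v).
have h2 := stableP (j + k) v; have h3 := b0 j (P *m v).
have : 4 ^+ k * (a (j + k) (P *m v) + b (j + k) (P *m v)) <= 4 ^+ k * (2 * a (j + k) (P *m v)).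
  by rewrite ler_wpM2l ?exprn_ge0 //; lra.
have := a0 j (P *m v).
rewrite [4 ^+ k * (2 * _)]mulrCA; lra.
Qed.

Let unstableP v : a 0 ((1%:M - P) *m v) = 0.
Proof. by rewrite a_at0 mulmxA mulmxBr mulmx1 PiP subrr mul0mx dot0r. Qed.

Let unstableP_cone k v : a k ((1%:M - P) *m v) <= b k ((1%:M - P) *m v).
Proof.
have [|h _] := @unstable_iter ((1%:M - P) *m v) 0 k; last by [].
by rewrite unstableP.
Qed.

Let unstableP_strong_cone k v :
  4 * a k ((1%:M - P) *m v) <= b k ((1%:M - P) *m v).
Proof.
case: k => [|k]; first by rewrite unstableP mulr0.
by have /unstable_step [_] := unstableP_cone k v.
Qed.

Lemma unstable_growth j k v :
  enorm (Z j *m ((1%:M - P) *m v)) <= 2 * 2^-1 ^+ k * enorm (Z (j + k) *m ((1%:M - P) *m v)).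
Proof.
rewrite enorm_le ?mulr_ge0 ?exprn_ge0 ?invr_ge0 //.
have -> : (2 * 2^-1 ^+ k) ^+ 2 = 4 / 4 ^+ k :> R.
  rewrite exprMn -exprM mulnC exprM [2^-1 ^+ 2]exprVn exprVn.
  by have -> : 2 ^+ 2 = 4 :> R by rewrite expr2; ring.
rewrite mulrAC ler_pdivlMr ?exprn_gt0 // mulrC !dot_Z.
set u := _ *m v.
have [_ h] := unstable_iter k (unstableP_cone j v).
have h2 := unstableP_cone j v; have h3 := a0 (j + k) u.
have h4 : 4 ^+ k * (a j u + b j u) <= 14 ^+ k * (2 * b j u).
  rewrite ler_pM ?exprn_ge0 ?addr_ge0 //; last by rewrite -/u in h2; lra.
  by rewrite lerXn2r ?nnegrE // ler_nat.
have := b0 (j + k) u; rewrite -/u in h h2.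
move: h4; rewrite [14 ^+ k * (2 * _)]mulrCA; lra.
Qed.

(** On the range of [P] the [ker Pi] component is at most half the [im Pi] component,
    on its kernel it is the other way round; the angle between the two invariant
    subspaces therefore does not degenerate along the orbit. *)
Lemma stable_projection_bound k v : enorm (Z k *m (P *m v)) <= 8 * enorm (Z k *m v).
Proof.
have half (x y : 'cV[R]_m) : 4 * dot x x <= dot y y -> enorm x <= 2^-1 * enorm y.
  move=> xy; rewrite enorm_le ?invr_ge0 //.
  have -> : 2^-1 ^+ 2 = 4^-1 :> R by rewrite expr2; field.
  lra.
pose s := Z k *m (P *m v); pose u := Z k *m ((1%:M - P) *m v).
have su : Z k *m v = s + u by rewrite /s /u -mulmxDr -mulmxDl addrC subrK mul1mx.
have hs : enorm (Pc *m s) <= 2^-1 * enorm (Pi *m s).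
  apply: half; have := stableP k.+1 v => /stable_step [+ _]; exact.
have hu : enorm (Pi *m u) <= 2^-1 * enorm (Pc *m u).
  by apply: half; apply: unstableP_strong_cone.
have proj_le (Q : 'M[R]_m) x : Q = Pi \/ Q = Pc -> enorm (Q *m x) <= enorm x.
  move=> QE; rewrite -[leRHS]mul1r enorm_le // expr1n mul1r [leRHS]dot_projection.
  by case: QE => ->; rewrite ?lerDl ?lerDr dot_ge0.
have h1 : enorm (Pi *m s) <= enorm (Z k *m v) + enorm (Pi *m u).
  have -> : Pi *m s = Pi *m (Z k *m v) - Pi *m u by rewrite su mulmxDr addrK.
  by apply: le_trans (enormB _ _) _; rewrite lerD2r proj_le //; left.
have h2 : enorm (Pc *m u) <= enorm (Z k *m v) + enorm (Pc *m s).
  have -> : Pc *m u = Pc *m (Z k *m v) - Pc *m s by rewrite su mulmxDr addrC addKr.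
  by apply: le_trans (enormB _ _) _; rewrite lerD2r proj_le //; right.
rewrite -/s.
have -> : s = Pi *m s + Pc *m s by rewrite -mulmxDl addrC subrK mul1mx.
apply: le_trans (enormD _ _) _; have := enorm_ge0 (Z k *m v); lra.
Qed.

End DiscreteDichotomy.

(** * From time steps to continuous time *)

Section Growth.
Variables (R : realType) (m : nat) (W X : R -> 'M[R]_m) (C : R).
Hypothesis dX : forall t : R, is_derive t 1 X (W t *m X t).
Hypothesis WC : forall (t : R) v, 0 < t -> enorm (W t *m v) <= C * enorm v.

Let dsol (v : 'cV[R]_m) (t : R) : is_derive t 1 (fun u => X u *m v) (W t *m (X t *m v)).
Proof. by rewrite mulmxA; apply: is_derive_mulmxr. Qed.

Let dot_field (v : 'cV[R]_m) (t : R) : 0 < t ->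
  `|dot (X t *m v) (W t *m (X t *m v))| <= C * dot (X t *m v) (X t *m v).
Proof.
move=> t0; apply: le_trans (cauchy_schwarz _ _) _.
rewrite -sqr_enorm expr2 mulrCA ler_wpM2l ?enorm_ge0 //.
exact: WC.
Qed.

Let expR_sqr (c : R) : expR c ^+ 2 = expR (2 * c).
Proof. by rewrite expr2 -expRD; congr expR; ring. Qed.

Lemma growth_forward s t (v : 'cV[R]_m) : 0 <= s -> s <= t ->
  enorm (X t *m v) <= expR (C * (t - s)) * enorm (X s *m v).
Proof.
move=> s0 st; rewrite enorm_le ?expR_ge0 // expR_sqr mulrA.
apply: (gronwall (f := fun u => dot (X u *m v) (X u *m v)) st) => u.
  exact: is_derive_dot_sqr (dsol v u).
move=> /andP[su _]; rewrite -mulrA ler_wpM2l //.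
apply: le_trans (ler_norm _) (dot_field _ _); exact: le_lt_trans su.
Qed.

Lemma growth_backward s t (v : 'cV[R]_m) : 0 <= s -> s <= t ->
  enorm (X s *m v) <= expR (C * (t - s)) * enorm (X t *m v).
Proof.
move=> s0 st; rewrite enorm_le ?expR_ge0 // expR_sqr mulrA.
have := @gronwall _ (fun u => - dot (X u *m v) (X u *m v))
  (fun u => - (2 * dot (X u *m v) (W u *m (X u *m v)))) (- (2 * C)) s t st.
rewrite mulrN lerN2 mulNr expRN ler_pdivrMl ?expR_gt0 //; apply=> u.
  by have := is_derive_dot_sqr (dsol v u) => ?; apply: is_deriveN.
move=> /andP[su _]; rewrite mulrNN -mulrN -mulrA ler_wpM2l //.
apply: le_trans (ler_norm _) _; rewrite normrN.
by apply: dot_field; apply: le_lt_trans su.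
Qed.

End Growth.

Section ContinuousDichotomy.
Variables (R : realType) (m : nat) (W X Y : R -> 'M[R]_m) (Pi : 'M[R]_m) (C tau : R).
Hypothesis dX : forall t : R, is_derive t 1 X (W t *m X t).
Hypotheses (YX : forall t, Y t *m X t = 1%:M) (X0 : X 0 = 1%:M).
Hypotheses (PiT : Pi^T = Pi) (PiPi : Pi *m Pi = Pi).
Hypothesis C0 : 0 <= C.
Hypothesis WC : forall (t : R) v, 0 < t -> enorm (W t *m v) <= C * enorm v.
Hypothesis tau0 : 0 < tau.

Let sqr_s t (v : 'cV[R]_m) := dot (Pi *m (X t *m v)) (Pi *m (X t *m v)).
Let sqr_u t (v : 'cV[R]_m) := dot ((1%:M - Pi) *m (X t *m v)) ((1%:M - Pi) *m (X t *m v)).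

Hypothesis contraction : forall s v, 0 <= s ->
  16 * sqr_s (s + tau) v <= 2 * sqr_s s v + sqr_u s v.
Hypothesis expansion : forall s v, 0 <= s ->
  15 * sqr_u s v <= sqr_u (s + tau) v + sqr_s s v.

(** The discrete dichotomy holds along the grid of the multiples of [tau]; from a time
    to the preceding grid point solutions change by a factor at most
    [G = expR (C * tau)], which is absorbed in the constant [K]. *)
Lemma dichotomy_of_time_steps : exponential_dichotomy W (\rank Pi).
Proof.
pose Z (k : nat) := X (k%:R * tau); pose Zi (k : nat) := Y (k%:R * tau).
have kS (k : nat) : k.+1%:R * tau = k%:R * tau + tau by rewrite -natr1 mulrDl mul1r.
have k0 (k : nat) : 0 <= k%:R * tau by rewrite mulr_ge0 // ltW.
have ZiZ k : Zi k *m Z k = 1%:M by apply: YX.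
have Z0 : Z 0 = 1%:M by rewrite /Z mul0r.
have zc k v : 16 * sqr_s (k.+1%:R * tau) v <= 2 * sqr_s (k%:R * tau) v + sqr_u (k%:R * tau) v.
  by rewrite kS; apply: contraction.
have ze k v : 15 * sqr_u (k%:R * tau) v <= sqr_u (k.+1%:R * tau) v + sqr_s (k%:R * tau) v.
  by rewrite kS; apply: expansion.
have [P [PiP PPi stableP]] := exists_stable_projection PiT PiPi ZiZ Z0 zc ze.
pose G := expR (C * tau).
have G0 : 0 < G by apply: expR_gt0.
have G1 : 1 <= G by rewrite -expR0 ler_expR mulr_ge0 // ltW.
(* The discrete rate is 1/2 for each step of length [tau]. *)
pose eta := ln 2 / tau.
have eta0 : 0 < eta by rewrite divr_gt0 // ln_gt0 // ltr1n.
have XY t : X t *m Y t = 1%:M by apply: mulmx1C.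
(* [floor t] is the index of the grid point preceding [t]. *)
pose floor (t : R) := Num.truncn (t / tau).
have floorP (t : R) : 0 <= t -> (floor t)%:R * tau <= t < (floor t).+1%:R * tau.
  move=> t0; have := @truncn_itv R (t / tau); rewrite divr_ge0 ?(ltW tau0) // => /(_ isT).
  by rewrite ler_pdivlMr // ltr_pdivrMr.
have floor_le (s t : R) : 0 <= s -> s <= t -> (floor s <= floor t)%N.
  by move=> s0 st; apply: le_truncn; rewrite ler_pM2r // invr_gt0.
have from_grid (t : R) (v : 'cV[R]_m) : 0 <= t -> enorm (X t *m v) <= G * enorm (Z (floor t) *m v).
  move=> t0; have /andP[h1 h2] := floorP t t0.
  apply: le_trans (growth_forward dX WC v (k0 _) h1) _.
  rewrite ler_wpM2r ?enorm_ge0 // ler_expR ler_wpM2l //.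
  by move: h2; rewrite kS; lra.
have to_grid (t : R) (v : 'cV[R]_m) : 0 <= t -> enorm (Z (floor t) *m v) <= G * enorm (X t *m v).
  move=> t0; have /andP[h1 h2] := floorP t t0.
  apply: le_trans (growth_backward dX WC v (k0 _) h1) _.
  rewrite ler_wpM2r ?enorm_ge0 // ler_expR ler_wpM2l //.
  by move: h2; rewrite kS; lra.
have half_pow (s t : R) : 0 <= s -> s <= t ->
    2^-1 ^+ (floor t - floor s) <= 2 * expR (- eta * (t - s)).
  move=> s0 st; have t0 : 0 <= t by apply: le_trans st.
  have /andP[_ h2] := floorP t t0; have /andP[h1 _] := floorP s s0.
  have fst := floor_le _ _ s0 st.
  set N := (floor t - floor s)%N.
  have NE : N%:R * tau = (floor t)%:R * tau - (floor s)%:R * tau.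
    by rewrite /N natrB // mulrBl.
  have -> : 2^-1 ^+ N = 2 * expR (- (ln 2 * N.+1%:R)) :> R.
    rewrite expRN expRM_natr lnK ?posrE // exprS invfM mulrA divff //.
    by rewrite mul1r exprVn.
  rewrite ler_wpM2l // ler_expR mulNr lerN2 /eta mulrAC ler_pdivrMr // -mulrA.
  rewrite ler_wpM2l ?ln_ge0 ?ler1n // -natr1 mulrDl mul1r NE.
  by move: h2; rewrite kS; lra.
have decay (s t : R) (v : 'cV[R]_m) : 0 <= s -> s <= t ->
    enorm (X t *m (P *m v)) <= 4 * G ^+ 2 * expR (- eta * (t - s)) * enorm (X s *m (P *m v)).
  move=> s0 st; have t0 : 0 <= t by apply: le_trans st.
  have fst := floor_le _ _ s0 st.
  have h1 := from_grid t (P *m v) t0; have h2 := to_grid s (P *m v) s0.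
  have h3 := stable_decay PiT PiPi zc ze stableP (floor s) (floor t - floor s) v.
  rewrite subnKC // in h3.
  apply: le_trans h1 _.
  apply: le_trans (ler_wpM2l (ltW G0) h3) _.
  apply: (@le_trans _ _ (G * (2 * (2 * expR (- eta * (t - s))) * (G * enorm (X s *m (P *m v)))))).
    rewrite ler_wpM2l ?(ltW G0) // ler_pM ?mulr_ge0 ?exprn_ge0 ?invr_ge0 ?enorm_ge0 //.
    by rewrite ler_wpM2l // half_pow.
  by rewrite le_eqVlt; apply/orP; left; apply/eqP; ring.
have growth (s t : R) (v : 'cV[R]_m) : 0 <= s -> s <= t ->
    enorm (X s *m ((1%:M - P) *m v)) <=
    4 * G ^+ 2 * expR (- eta * (t - s)) * enorm (X t *m ((1%:M - P) *m v)).
  move=> s0 st; have t0 : 0 <= t by apply: le_trans st.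
  have fst := floor_le _ _ s0 st.
  have h1 := from_grid s ((1%:M - P) *m v) s0; have h2 := to_grid t ((1%:M - P) *m v) t0.
  have h3 := unstable_growth PiT PiPi Z0 zc ze PiP (floor s) (floor t - floor s) v.
  rewrite subnKC // in h3.
  apply: le_trans h1 _.
  apply: le_trans (ler_wpM2l (ltW G0) h3) _.
  apply: (@le_trans _ _ (G * (2 * (2 * expR (- eta * (t - s))) *
      (G * enorm (X t *m ((1%:M - P) *m v)))))).
    rewrite ler_wpM2l ?(ltW G0) // ler_pM ?mulr_ge0 ?exprn_ge0 ?invr_ge0 ?enorm_ge0 //.
    by rewrite ler_wpM2l // half_pow.
  by rewrite le_eqVlt; apply/orP; left; apply/eqP; ring.
have bounded (s : R) (v : 'cV[R]_m) : 0 <= s ->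
    enorm (X s *m (P *m v)) <= 8 * G ^+ 2 * enorm (X s *m v).
  move=> s0; have h1 := from_grid s (P *m v) s0; have h2 := to_grid s v s0.
  have h3 := stable_projection_bound PiT PiPi Z0 zc ze PiP stableP (floor s) v.
  apply: le_trans h1 _; apply: le_trans (ler_wpM2l (ltW G0) h3) _.
  have -> : 8 * G ^+ 2 * enorm (X s *m v) = G * (8 * (G * enorm (X s *m v))) by ring.
  by rewrite !ler_wpM2l // ltW.
exists (fun t s => X t *m Y s); split; first exact: fundamental_evolution_operator.
pose K := 4 * G ^+ 2 * (1 + 8 * G ^+ 2).
have K8 : 8 * G ^+ 2 <= 1 + 8 * G ^+ 2 by rewrite lerDr.
have K80 : 0 <= 1 + 8 * G ^+ 2 by rewrite addr_ge0 ?mulr_ge0 ?exprn_ge0 // ltW.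
have G20 : 0 <= 4 * G ^+ 2 by rewrite mulr_ge0 ?exprn_ge0 // ltW.
exists (fun t => X t *m P *m Y t), K, eta; split => //.
- rewrite mulr_gt0 ?mulr_gt0 ?exprn_gt0 //.
  by rewrite (lt_le_trans _ K8) // mulr_gt0 ?exprn_gt0.
- move=> t _; split.
    rewrite -!mulmxA [Y t *m (X t *m _)]mulmxA YX mul1mx [P *m (P *m _)]mulmxA.
    by rewrite (stable_projection_idempotent PiP PPi).
  rewrite -(rank_stable_projection PiP PPi).
  rewrite mxrankMfree; last by rewrite row_free_unit; case/mulmx1_unit: (XY t).
  rewrite -mxrank_tr trmx_mul mxrankMfree ?mxrank_tr //.
  by rewrite row_free_unit unitmx_tr; case/mulmx1_unit: (XY t).
- move=> t s _ _; rewrite -!mulmxA [Y t *m (X t *m _)]mulmxA YX mul1mx.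
  by rewrite [Y s *m (X s *m _)]mulmxA YX mul1mx.
- move=> t s s0 st; have t0 : 0 <= t by apply: le_trans st.
  have e0 := expR_ge0 (- eta * (t - s)).
  have KE (v : 'cV[R]_m) : 4 * G ^+ 2 * expR (- eta * (t - s)) * ((1 + 8 * G ^+ 2) * enorm v)
      = K * expR (- eta * (t - s)) * enorm v by rewrite /K; ring.
  have Ke0 : 0 <= K * expR (- eta * (t - s)) by rewrite mulr_ge0 // mulr_ge0.
  split; apply: opnorm_le => // v; rewrite -KE.
    have -> : X t *m Y s *m (X s *m P *m Y s) *m v = X t *m (P *m (Y s *m v)).
      by rewrite -!mulmxA [Y s *m (X s *m _)]mulmxA YX mul1mx.
    apply: le_trans (decay _ _ _ s0 st) _.
    apply: ler_wpM2l; first exact: mulr_ge0.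
    apply: le_trans (bounded s (Y s *m v) s0) _.
    by rewrite mulmxA XY mul1mx ler_wpM2r ?enorm_ge0.
  have -> : invmx (X t *m Y s) *m (1%:M - X t *m P *m Y t) *m v
      = X s *m ((1%:M - P) *m (Y t *m v)).
    have -> : invmx (X t *m Y s) = X s *m Y t.
      have inv1 : (X s *m Y t) *m (X t *m Y s) = 1%:M.
        by rewrite -mulmxA [Y t *m _]mulmxA YX mul1mx XY.
      have [_ u2] := mulmx1_unit inv1.
      by rewrite -[LHS]mul1mx -inv1 mulmxK.
    rewrite -!mulmxA; congr (X s *m _).
    rewrite mulmxBl mul1mx mulmxBr mulmxBl mul1mx -!mulmxA.
    by rewrite [Y t *m (X t *m _)]mulmxA YX mul1mx.
  apply: le_trans (growth _ _ _ s0 st) _.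
  apply: ler_wpM2l; first exact: mulr_ge0.
  rewrite mulmxBl mul1mx mulmxBr.
  apply: le_trans (enormB _ _) _; rewrite mulrDl mul1r.
  apply: lerD; first by rewrite mulmxA XY mul1mx.
  by apply: le_trans (bounded t (Y t *m v) t0) _; rewrite mulmxA XY mul1mx.
Qed.

End ContinuousDichotomy.

(** * Small coupling *)

Section NearlyDecoupled.
Variable R : realType.

(** The component in [im Pi] is dissipated, with a rate normalised to 1, and the
    component in [ker Pi] follows the field [V]; [delta] measures the coupling between
    them. *)
Definition nearly_decoupled m (Pi : 'M[R]_m) (V W : R -> 'M[R]_m) (C delta : R) : Prop :=
  forall (t : R) (x : 'cV[R]_m), 0 < t ->
    [/\ enorm (W t *m x) <= C * enorm x,
        dot (Pi *m x) (W t *m x) <= - dot (Pi *m x) (Pi *m x) + delta * enorm x * enorm (Pi *m x) &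
        enorm ((1%:M - Pi) *m (W t *m x) - V t *m ((1%:M - Pi) *m x)) <= delta * enorm x].

(** The instability of the isolated equations, in terms of their fundamental pair. *)
Definition backward_contraction m (X Y : R -> 'M[R]_m) (K0 eta0 : R) : Prop :=
  forall (t s : R) (v : 'cV[R]_m), s < t ->
    enorm (X s *m (Y t *m v)) <= K0 * expR (- eta0 * (t - s)) * enorm v.

Section OneStep.
Variables (m : nat) (Pi : 'M[R]_m) (V W X Y Xv Yv : R -> 'M[R]_m).
Variables (C delta K0 eta0 tau : R).
Hypotheses (C0 : 0 <= C) (delta0 : 0 <= delta) (K00 : 0 <= K0) (eta00 : 0 <= eta0).
Hypothesis tau0 : 0 < tau.
Hypotheses (PiT : Pi^T = Pi) (PiPi : Pi *m Pi = Pi).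
Hypothesis XY : fundamental_pair W X Y.
Hypothesis XYv : fundamental_pair V Xv Yv.
Hypothesis contractV : backward_contraction Xv Yv K0 eta0.
Hypothesis decoupled : nearly_decoupled Pi V W C delta.

Let G := expR (C * tau).
Let Pc : 'M[R]_m := 1%:M - Pi.

Let dX (t : R) : is_derive t 1 X (W t *m X t). Proof. by case: XY. Qed.

Let WC (t : R) (v : 'cV[R]_m) : 0 < t -> enorm (W t *m v) <= C * enorm v.
Proof. by move=> t0; have [] := decoupled v t0. Qed.

Let step_growth s u v : 0 <= s -> s <= u <= s + tau -> enorm (X u *m v) <= G * enorm (X s *m v).
Proof.
move=> s0 /andP[su us]; apply: le_trans (growth_forward dX WC v s0 su) _.
by rewrite ler_wpM2r ?enorm_ge0 // ler_expR ler_wpM2l //; lra.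
Qed.

Let dx (v : 'cV[R]_m) (t : R) : is_derive t 1 (fun u => X u *m v) (W t *m (X t *m v)).
Proof. by rewrite mulmxA; apply: is_derive_mulmxr. Qed.

(** Young's inequality turns the coupling term into half of the dissipation plus a
    constant, and Gronwall's lemma applies to the excess over this constant. *)
Lemma dissipative_step s v : 0 <= s ->
  dot (Pi *m (X (s + tau) *m v)) (Pi *m (X (s + tau) *m v)) <=
  expR (- tau) * dot (Pi *m (X s *m v)) (Pi *m (X s *m v))
  + (delta * G) ^+ 2 * dot (X s *m v) (X s *m v).
Proof.
move=> s0.
set r := (delta * G) ^+ 2 * dot (X s *m v) (X s *m v).
have r0 : 0 <= r by rewrite mulr_ge0 ?sqr_ge0 ?dot_ge0.
pose y u := Pi *m (X u *m v).
have st : s <= s + tau by rewrite lerDl ltW.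
have dy (u : R) : is_derive u 1 y (Pi *m (W u *m (X u *m v))).
  exact: is_derive_mulmxl.
have := @gronwall _ (fun u => dot (y u) (y u) - r)
  (fun u => 2 * dot (y u) (Pi *m (W u *m (X u *m v)))) (-1) s (s + tau) st.
have -> : -1 * (s + tau - s) = - tau by ring.
have eE : 0 <= expR (- tau) * r by rewrite mulr_ge0 ?expR_ge0.
move=> H; suff : dot (y (s + tau)) (y (s + tau)) - r <= expR (- tau) * (dot (y s) (y s) - r).
  by rewrite mulrBr /y; lra.
apply: H => u.
  have d1 := is_derive_dot_sqr (dy u); have d2 := is_derive_cst r u (1 : R).
  by have := is_deriveB d1 d2; rewrite subr0.
move=> /andP[su us].
have u0 : 0 < u by apply: le_lt_trans su.
have [_ diss _] := decoupled (X u *m v) u0.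
have -> : dot (y u) (Pi *m (W u *m (X u *m v))) = dot (y u) (W u *m (X u *m v)).
  by rewrite /y -[in LHS]PiT -dot_mulmxl PiT mulmxA PiPi.
have xG : enorm (X u *m v) <= G * enorm (X s *m v).
  by apply: step_growth => //; rewrite !ltW.
rewrite -/(y u) in diss.
have h1 : delta * enorm (X u *m v) * enorm (y u) <= delta * G * enorm (X s *m v) * enorm (y u).
  by rewrite ler_wpM2r ?enorm_ge0 // -mulrA ler_wpM2l.
set e := delta * G * enorm (X s *m v) in h1.
have -> : r = e ^+ 2 by rewrite /e exprMn sqr_enorm.
have h2 : 2 * (e * enorm (y u)) <= e ^+ 2 + dot (y u) (y u).
  by rewrite -sqr_enorm; have := sqr_ge0 (e - enorm (y u)); rewrite sqrrB; lra.
by rewrite mulN1r; lra.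
Qed.

(** Variation of constants, backwards in time: only the backward evolution of [V] is
    controlled, so the component at time [s] is estimated from that at [s + tau]. *)
Lemma expansive_step s v : 0 <= s ->
  enorm (Pc *m (X s *m v)) <=
  K0 * expR (- eta0 * tau) * enorm (Pc *m (X (s + tau) *m v))
  + K0 * delta * tau * G * enorm (X s *m v).
Proof.
move=> s0; have [_ dYv YXv _] := XYv.
have st : s <= s + tau by rewrite lerDl ltW.
pose z u := Pc *m (X u *m v).
(* Pulling [z] back to time [s] along the isolated equations removes the field [V]. *)
pose g u := Xv s *m (Yv u *m z u).
have XYv1 : Xv s *m Yv s = 1%:M by apply: mulmx1C.
have gs : g s = z s by rewrite /g mulmxA XYv1 mul1mx.
have := @mean_value_enorm _ _ g
  (fun u => Xv s *m (Yv u *m (Pc *m (W u *m (X u *m v)) - V u *m z u)))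
  (K0 * (delta * (G * enorm (X s *m v)))) s (s + tau) st.
have -> : s + tau - s = tau by ring.
rewrite gs => H.
have {H} : enorm (g (s + tau) - z s) <= K0 * (delta * (G * enorm (X s *m v))) * tau.
  apply: H => u.
    apply: is_derive_mulmxl.
    have dz : is_derive u 1 z (Pc *m (W u *m (X u *m v))) by apply: is_derive_mulmxl.
    have := is_derive_mulmx (dYv u) dz.
    by rewrite mulNmx -mulmxA addrC -mulmxBr.
  move=> /andP[su us].
  have u0 : 0 < u by apply: le_lt_trans su.
  have [_ _ dec] := decoupled (X u *m v) u0.
  apply: le_trans (contractV _ su) _.
  have xG : enorm (X u *m v) <= G * enorm (X s *m v).
    by apply: step_growth => //; rewrite !ltW.
  apply: ler_pM; rewrite ?enorm_ge0 ?mulr_ge0 ?expR_ge0 //.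
    rewrite -[leRHS]mulr1 ler_wpM2l // -expR0 ler_expR mulNr oppr_le0 mulr_ge0 //.
    by rewrite subr_ge0 ltW.
  by apply: le_trans dec _; rewrite ler_wpM2l.
have gt : enorm (g (s + tau)) <= K0 * expR (- eta0 * tau) * enorm (z (s + tau)).
  have -> : - eta0 * tau = - eta0 * (s + tau - s) by ring.
  by apply: contractV; rewrite ltrDl.
have : enorm (z s) <= enorm (g (s + tau)) + enorm (g (s + tau) - z s).
  by rewrite -[z s in leLHS](subKr (g (s + tau))) enormB.
rewrite -/(z s) -/(z (s + tau)).
have -> : K0 * delta * tau * G * enorm (X s *m v) = K0 * (delta * (G * enorm (X s *m v))) * tau.
  by ring.
lra.
Qed.

Hypothesis small1 : expR (- tau) <= 16^-1.
Hypothesis small2 : K0 * expR (- eta0 * tau) <= 6^-1.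
Hypothesis small3 : delta * G <= 6^-1.
Hypothesis small4 : K0 * delta * tau * G <= 6^-1.

(** By [small1] to [small4], the two one-step estimates give the inequalities
    [16 a' <= 2 a + b] and [15 b <= b' + a] on which the cone argument rests. *)
Lemma dichotomy_of_small_coupling : exponential_dichotomy W (\rank Pi).
Proof.
have [_ _ YX X0] := XY.
have G0 : 0 <= G by apply: expR_ge0.
have dotP s (v : 'cV[R]_m) : dot (X s *m v) (X s *m v) =
    dot (Pi *m (X s *m v)) (Pi *m (X s *m v)) + dot (Pc *m (X s *m v)) (Pc *m (X s *m v)).
  exact: dot_projection.
have small_sqr (e : R) : 0 <= e -> e <= 6^-1 -> e ^+ 2 <= 36^-1.
  move=> e0 e6; have -> : 36^-1 = 6^-1 ^+ 2 :> R by rewrite expr2; field.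
  by rewrite lerXn2r // nnegrE invr_ge0.
apply: (dichotomy_of_time_steps dX YX X0 PiT PiPi C0 WC tau0) => s v s0.
  have := dissipative_step v s0; rewrite dotP.
  set a := dot (Pi *m (X s *m v)) _; set b := dot (Pc *m _) _; set a' := dot _ _.
  have a0 : 0 <= a by apply: dot_ge0.
  have b0 : 0 <= b by apply: dot_ge0.
  have h1 : expR (- tau) * a <= 16^-1 * a by apply: ler_wpM2r.
  have h2 : (delta * G) ^+ 2 * (a + b) <= 36^-1 * (a + b).
    by apply: ler_wpM2r; [apply: addr_ge0|apply: small_sqr; rewrite ?mulr_ge0].
  rewrite -/Pc -/a -/b; lra.
have := expansive_step v s0.
have nx := dotP s v.
rewrite -/Pc.
have e0 := enorm_ge0 (Pc *m (X s *m v)).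
set p := K0 * expR _; set q := K0 * _ * _ * _.
have p0 : 0 <= p by rewrite mulr_ge0 ?expR_ge0.
have q0 : 0 <= q by rewrite !mulr_ge0 // ltW.
have p6 : p <= 6^-1 by exact: small2.
have q6 : q <= 6^-1 by exact: small4.
move: p q p0 q0 p6 q6 => p q p0 q0 p6 q6.
move=> H.
have {H} : enorm (Pc *m (X s *m v)) ^+ 2 <=
    (p * enorm (Pc *m (X (s + tau) *m v)) + q * enorm (X s *m v)) ^+ 2.
  apply: lerXn2r => //; rewrite nnegrE; apply: addr_ge0.
    exact: mulr_ge0 p0 (enorm_ge0 _).
  exact: mulr_ge0 q0 (enorm_ge0 _).
have sq2 (x y : R) : (x + y) ^+ 2 <= 2 * x ^+ 2 + 2 * y ^+ 2.
  have -> : 2 * x ^+ 2 + 2 * y ^+ 2 = (x + y) ^+ 2 + (x - y) ^+ 2 by ring.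
  by rewrite lerDl sqr_ge0.
move=> /le_trans /(_ (sq2 _ _)); rewrite !exprMn !sqr_enorm nx.
set a := dot (Pi *m (X s *m v)) _; set b := dot (Pc *m (X s *m v)) _; set b' := dot (Pc *m _) _.
have a0 : 0 <= a by apply: dot_ge0.
have b0 : 0 <= b by apply: dot_ge0.
have b'0 : 0 <= b' by apply: dot_ge0.
have h1 : p ^+ 2 * b' <= 36^-1 * b' by apply: ler_wpM2r => //; apply: small_sqr.
have h2 : q ^+ 2 * (a + b) <= 36^-1 * (a + b).
  by apply: ler_wpM2r; [apply: addr_ge0|apply: small_sqr].
lra.
Qed.

End OneStep.

(** The threshold [delta] depends on the fields only through [C], [K0] and [eta0], and
    not on the dimension, so one value serves all graph sizes. *)
Theorem exists_coupling_threshold (C K0 eta0 : R) : 0 <= C -> 0 < K0 -> 0 < eta0 ->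
  exists2 delta, 0 < delta &
  forall m (Pi : 'M[R]_m) (V W X Y Xv Yv : R -> 'M[R]_m),
    Pi^T = Pi -> Pi *m Pi = Pi ->
    fundamental_pair W X Y -> fundamental_pair V Xv Yv ->
    backward_contraction Xv Yv K0 eta0 -> nearly_decoupled Pi V W C delta ->
    exponential_dichotomy W (\rank Pi).
Proof.
move=> C0 K00 eta00.
(* Large enough for [small1] and [small2], by [1 + y <= expR y]. *)
pose tau := 16 + 6 * K0 / eta0.
have tau0 : 0 < tau by rewrite addr_gt0 // divr_gt0 // mulr_gt0.
have q0 : 0 < 6 * K0 / eta0 by rewrite divr_gt0 // mulr_gt0.
pose G := expR (C * tau).
have G0 : 0 < G by apply: expR_gt0.
have Kt0 : 0 < K0 * tau by rewrite mulr_gt0.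
pose delta := (6 * (1 + K0 * tau) * G)^-1.
have delta0 : 0 < delta by rewrite invr_gt0 !mulr_gt0 // addr_gt0.
have dG : delta * G = 6^-1 / (1 + K0 * tau).
  by rewrite /delta; field; rewrite !gt_eqF //; lra.
exists delta => // m Pi V W X Y Xv Yv PiT PiPi XY XYv cV dec.
apply: (dichotomy_of_small_coupling C0 (ltW delta0) (ltW K00) (ltW eta00) tau0 PiT PiPi
  XY XYv cV dec).
- rewrite expRN lef_pV2 ?posrE ?expR_gt0 //.
  by apply: le_trans (expR_ge1Dx _); rewrite /tau; lra.
- rewrite mulNr expRN ler_pdivrMr ?expR_gt0 //.
  suff : 6 * K0 <= expR (eta0 * tau) by lra.
  apply: le_trans (expR_ge1Dx _).
  have -> : eta0 * tau = 16 * eta0 + 6 * K0 by rewrite /tau; field; rewrite gt_eqF.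
  lra.
- by rewrite -/G dG ler_piMr ?invr_ge0 // invf_le1; lra.
- have -> : K0 * delta * tau * expR (C * tau) = delta * G * (K0 * tau) by rewrite /G; ring.
  rewrite dG -mulrA ler_piMr ?invr_ge0 // mulrC ler_pdivrMr; lra.
Qed.

End NearlyDecoupled.

(** * Degrees of a random graph *)

Section RandomGraph.
Variable R : realType.

(** Independence of the edges: a graph amounts to a function on the pairs [i <= j], and
    a sum over such functions of a product is a product of sums. *)
Lemma sum_graph_prod n (F : 'I_n -> 'I_n -> bool -> R) :
  \sum_(g : graph n) \prod_(i < n) \prod_(j < n | (i <= j)%N) F i j (val g i j) =
  \prod_(i < n) \prod_(j < n | (i <= j)%N) (F i j true + F i j false).
Proof.
pose P (p : 'I_n * 'I_n) := (p.1 <= p.2)%N.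
pose F' (p : 'I_n * 'I_n) b := F p.1 p.2 b.
rewrite (pair_big_dep xpredT (fun i j : 'I_n => (i <= j)%N)
  (fun i j => F i j true + F i j false)) /=.
transitivity (\prod_(p | P p) \sum_(b : bool) F' p b); last first.
  by apply: eq_bigr => p _; rewrite big_bool.
rewrite (big_distr_big_dep false P (fun _ => predT) F') /=.
pose restrict (g : graph n) : {ffun 'I_n * 'I_n -> bool} :=
  [ffun p => P p && val g p.1 p.2].
pose sym (f : {ffun 'I_n * 'I_n -> bool}) : 'M[bool]_n :=
  \matrix_(i, j) f (if (i <= j)%N then (i, j) else (j, i)).
have symT f : (sym f)^T == sym f.
  apply/eqP/matrixP => i j; rewrite !mxE.
  by case: (ltngtP i j) => // /ord_inj ->.
pose extend f : graph n := exist _ (sym f) (symT f).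
rewrite (reindex_onto restrict extend) /=; last first.
  move=> f /pfamilyP [/fintype.subsetP fP _]; apply/ffunP => -[i j]; rewrite ffunE /= mxE /P /=.
  case: leqP => //= ji; apply/esym/negbTE/negP => fij.
  have /fP : (i, j) \in false.-support f by rewrite unfold_in /= fij.
  by rewrite unfold_in /= /P /= leqNgt ji.
apply: eq_big => [g|g _].
  apply/esym/andP; split.
    apply/pfamilyP; split=> //; apply/fintype.subsetP => p; rewrite unfold_in /= ffunE.
    by rewrite -topredE /=; case: (P p).
  apply/eqP/val_inj/matrixP => i j; rewrite /= mxE ffunE /P /=.
  case: (leqP i j) => [->//|/ltnW -> /=].
  by have /eqP/matrixP/(_ i j) := valP g; rewrite mxE.
rewrite (pair_big_dep xpredT (fun i j : 'I_n => (i <= j)%N) (fun i j => F i j (val g i j))) /=.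
by apply: eq_bigr => -[i j] /= ij; rewrite /F' ffunE /P /= ij.
Qed.

(** Among the pairs [a <= b], those that contain [i0] are the [(i0, b)] and the
    [(a, i0)]; each [j] occurs in exactly one of them. *)
Lemma prod_edges_at n (i0 : 'I_n) (h : 'I_n -> R) :
  \prod_(a < n) \prod_(b < n | (a <= b)%N)
     (if a == i0 then h b else if b == i0 then h a else 1) = \prod_(j < n) h j.
Proof.
rewrite (bigD1 i0) //= eqxx [RHS](bigID (fun j : 'I_n => (i0 <= j)%N)) /=; congr (_ * _).
rewrite big_mkcond [RHS]big_mkcond /=; apply: eq_bigr => a _.
have [->|ai] := eqVneq a i0; first by rewrite leqnn.
rewrite -ltnNge ltn_neqAle (inj_eq val_inj) ai /=.
case: leqP => ia; first by rewrite (bigD1 i0) //= eqxx big1 ?mulr1 // => b /andP[_ /negbTE ->].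
rewrite big1 // => b ab; case: eqP => // bi.
by move: ab; rewrite bi leqNgt ia.
Qed.

Section FixedSize.
Variables (w : nat -> nat -> R) (n : nat).
Hypothesis n1 : (1 <= n)%N.
Hypothesis hw : forall i, (1 <= i <= n)%N -> 0 < w n i.
Hypothesis wle : forall i, (1 <= i <= n)%N -> w n i <= wmax w n.
Hypothesis wsq : wmax w n ^+ 2 <= wsum w n.

Let pos (i : 'I_n) : 0 < w n i.+1.
Proof. by apply: hw; rewrite ltn_ord. Qed.

Let wsumE : wsum w n = \sum_(j < n) w n j.+1.
Proof. by rewrite /wsum big_add1 /= big_mkord. Qed.

Let wsum_gt0 : 0 < wsum w n.
Proof.
rewrite wsumE (bigD1 (Ordinal n1)) //= ltr_wpDr // ?hw ?n1 //.
by apply: sumr_ge0 => j _; rewrite ltW.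
Qed.

Let p (i j : 'I_n) : R := edge_prob w i j.

Let p_ge0 (i j : 'I_n) : 0 <= p i j.
Proof. by rewrite /p /edge_prob divr_ge0 ?mulr_ge0 // ltW. Qed.

Let p_le1 (i j : 'I_n) : p i j <= 1.
Proof.
rewrite /p /edge_prob ler_pdivrMr // mul1r; apply: le_trans wsq.
by rewrite expr2 ler_pM ?(ltW (pos _)) // wle // ltn_ord.
Qed.

Let sum_p (i : 'I_n) : \sum_(j < n) p i j = w n i.+1.
Proof.
rewrite /p /edge_prob -mulr_suml -mulr_sumr -wsumE mulfK // gt_eqF //.
Qed.

Lemma graph_weight_ge0 (g : graph n) : 0 <= graph_weight w g.
Proof.
apply: prodr_ge0 => i _; apply: prodr_ge0 => j _.
by case: ifP => _; rewrite ?p_ge0 // subr_ge0 p_le1.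
Qed.

Lemma sum_graph_weight : \sum_(g : graph n) graph_weight w g = 1.
Proof.
rewrite /graph_weight (sum_graph_prod (fun i j b => if b then p i j else 1 - p i j)).
by rewrite big1 // => i _; rewrite big1 // => j _; rewrite addrC subrK.
Qed.

Lemma graph_prob_le1 (E : set (graph n)) : graph_prob w E <= 1.
Proof.
rewrite -sum_graph_weight /graph_prob big_mkcond; apply: ler_sum => g _.
by case: ifP => // _; apply: graph_weight_ge0.
Qed.

Lemma graph_prob_sub (E F : set (graph n)) : E `<=` F -> graph_prob w E <= graph_prob w F.
Proof.
move=> EF; rewrite /graph_prob big_mkcond [leRHS]big_mkcond; apply: ler_sum => g _.
have := graph_weight_ge0 g; case: asboolP => [/EF h|_]; last by case: ifP.
by case: asboolP.
Qed.

Lemma graph_prob_union_bound (B : 'I_n -> set (graph n)) :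
  1 - \sum_i graph_prob w (B i) <= graph_prob w [set g | forall i, ~ B i g].
Proof.
rewrite lerBlDr -sum_graph_weight /graph_prob.
under [X in _ <= _ + X]eq_bigr do rewrite big_mkcond.
rewrite exchange_big /= [X in _ <= X + _]big_mkcond -big_split /=.
apply: ler_sum => g _; have w0 := graph_weight_ge0 g.
have s0 : 0 <= \sum_(i < n) (if `[< B i g >] then graph_weight w g else 0).
  by apply: sumr_ge0 => i _; case: ifP.
case: asboolP => [_|/existsNP[i /contrapT Bi]]; first by rewrite lerDl.
rewrite add0r (bigD1 i) //=; case: asboolP => // _.
by rewrite lerDl; apply: sumr_ge0 => j _; case: ifP.
Qed.

Lemma graph_probU (E F : set (graph n)) :
  graph_prob w (E `|` F) <= graph_prob w E + graph_prob w F.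
Proof.
rewrite /graph_prob [X in X + _]big_mkcond [X in _ + X]big_mkcond -big_split big_mkcond /=.
apply: ler_sum => g _; have w0 := graph_weight_ge0 g.
case: asboolP => [[h|h]|_]; last by apply: addr_ge0; case: ifP.
  by case: (asboolP (E g)) => // _; rewrite lerDl; case: ifP.
by case: (asboolP (F g)) => // _; rewrite lerDr; case: ifP.
Qed.

(** The edges at a node are independent, so the moment generating function of
    its degree is a product; [1 + y <= exp y] bounds each factor. *)
Lemma degree_mgf (i : 'I_n) (s : R) :
  \sum_(g : graph n) graph_weight w g * expR (s * degree R g i)
    <= expR ((expR s - 1) * w n i.+1).
Proof.
pose phi (b : bool) : R := if b then expR s else 1.
have wE (g : graph n) : graph_weight w g * expR (s * degree R g i) =
    \prod_(a < n) \prod_(b < n | (a <= b)%N)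
      ((if val g a b then p a b else 1 - p a b) *
       (if a == i then phi (val g a b) else if b == i then phi (val g a b) else 1)).
  have -> : expR (s * degree R g i) = \prod_(j < n) phi (val g i j).
    rewrite /degree mulr_sumr expR_sum; apply: eq_bigr => j _.
    by rewrite mxE /phi; case: (val g i j); rewrite ?mulr1 ?mulr0 ?expR0.
  rewrite -(prod_edges_at i) /graph_weight -big_split /=; apply: eq_bigr => a _.
  rewrite -big_split /=; apply: eq_bigr => b ab; congr (_ * _).
  have [->//|_] := eqVneq a i; have [->|//] := eqVneq b i.
  by have /eqP/matrixP/(_ a i) := valP g; rewrite mxE => ->.
rewrite (eq_bigr _ (fun g _ => wE g)).
rewrite (sum_graph_prod (fun a b x => (if x then p a b else 1 - p a b) *
       (if a == i then phi x else if b == i then phi x else 1))) /=.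
pose h j := 1 + (expR s - 1) * p i j.
have -> : \prod_(a < n) \prod_(b < n | (a <= b)%N)
    (p a b * (if a == i then expR s else if b == i then expR s else 1) +
     (1 - p a b) * (if a == i then 1 else if b == i then 1 else 1)) = \prod_j h j.
  rewrite -[RHS](prod_edges_at i); apply: eq_bigr => a _; apply: eq_bigr => b _.
  have [->|_] := eqVneq a i; first by rewrite /h; ring.
  have [->|_] := eqVneq b i; last by ring.
  rewrite /h; have -> : p a i = p i a by rewrite /p /edge_prob [w n a.+1 * _]mulrC.
  ring.
rewrite -sum_p mulr_sumr expR_sum; apply: ler_prod => j _.
rewrite expR_ge1Dx andbT /h.
have := p_ge0 i j; have := p_le1 i j; have := expR_gt0 s => e0 h1 h2.
have -> : 1 + (expR s - 1) * p i j = (1 - p i j) + expR s * p i j by ring.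
by rewrite addr_ge0 ?subr_ge0 // mulr_ge0 // ltW.
Qed.

Lemma chernoff (i : 'I_n) (s x : R) (E : set (graph n)) :
  (forall g, E g -> s * x <= s * degree R g i) ->
  graph_prob w E <= expR ((expR s - 1) * w n i.+1 - s * x).
Proof.
move=> HE; rewrite expRD expRN ler_pdivlMr ?expR_gt0 //.
apply: le_trans (degree_mgf i s); rewrite /graph_prob big_mkcond mulr_suml.
apply: ler_sum => g _; have w0 := graph_weight_ge0 g.
case: asboolP => [/HE h|_]; last by rewrite mul0r mulr_ge0 ?expR_ge0.
by rewrite ler_wpM2l // ler_expR.
Qed.

Lemma degree_upper_tail (i : 'I_n) (x : R) :
  graph_prob w [set g | x < degree R g i] <= expR (w n i.+1 - x / 2).
Proof.
(* The exponent 1/2 suffices because [expR 2^-1 <= 2]. *)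
apply: le_trans (@chernoff i 2^-1 x _ _) _.
  by move=> g /= /ltW; rewrite ler_pM2l // invr_gt0.
rewrite ler_expR [x / 2]mulrC lerD2r -[leRHS]mul1r ler_wpM2r ?(ltW (pos i)) //.
have := expR_ge1Dx (- 2^-1 : R); rewrite expRN.
have e0 := expR_gt0 (2^-1 : R).
have h : (expR 2^-1) * (expR 2^-1)^-1 = 1 :> R by rewrite mulfV // gt_eqF.
move=> h2; have : expR 2^-1 * (1 - 2^-1) <= expR 2^-1 * (expR 2^-1)^-1 :> R.
  by rewrite ler_pM2l.
by rewrite h; lra.
Qed.

Lemma degree_lower_tail (i : 'I_n) (x : R) :
  graph_prob w [set g | degree R g i < x] <= expR (x - w n i.+1 / 2).
Proof.
(* The exponent -1 suffices because [expR (- 1) <= 2^-1]. *)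
apply: le_trans (@chernoff i (-1) x _ _) _.
  by move=> g /= /ltW; rewrite !mulN1r lerN2.
rewrite ler_expR mulN1r opprK addrC lerD2l.
have -> : - (w n i.+1 / 2) = (- 2^-1) * w n i.+1 by ring.
rewrite ler_wpM2r ?(ltW (pos i)) //.
have := expR_ge1Dx (1 : R); rewrite expRN => h.
have : (expR 1)^-1 <= 2^-1 :> R by rewrite lef_pV2 ?posrE ?expR_gt0 //; lra.
lra.
Qed.

End FixedSize.
End RandomGraph.

(** * Concentration of the degrees *)

Section Asymptotics.
Variable R : realType.

Lemma powR_ge_eventually (b A : R) : 0 < b -> exists2 B, 0 < B & forall x, B <= x -> A <= x `^ b.
Proof.
move=> b0; pose A' := Num.max A 1.
have A0 : 0 < A' by rewrite lt_max ltr01 orbT.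
exists (A' `^ b^-1) => [|x Bx]; first exact: powR_gt0.
apply: (@le_trans _ _ A'); first by rewrite le_max lexx.
have -> : A' = (A' `^ b^-1) `^ b by rewrite -powRrM mulVf ?gt_eqF // powRr1 // ltW.
apply: ge0_ler_powR => //; rewrite ?nnegrE ?powR_ge0 //; first exact: ltW.
by apply: le_trans Bx; apply: powR_ge0.
Qed.

Lemma sublinear_powR_eventually (b A : R) : b < 1 ->
  exists2 B, 0 < B & forall x, B <= x -> A * x `^ b <= x.
Proof.
move=> b1; have [|B B0 HB] := @powR_ge_eventually (1 - b) A; first by rewrite subr_gt0.
exists B => // x Bx; have x0 : 0 < x by apply: lt_le_trans Bx.
have {2}-> : x = x `^ (1 - b) * x `^ b.
  by rewrite -powRD ?subrK ?powRr1 ?(ltW x0) // gt_eqF ?implybT.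
by rewrite ler_wpM2r ?powR_ge0 // HB.
Qed.

Lemma near_ln_ge (A : R) : \forall n \near \oo, A <= ln (n%:R : R).
Proof.
near=> n; have nA : expR A <= n%:R by near: n; exact: nbhs_infty_ger.
have n0 : (0 : R) < n%:R by apply: lt_le_trans nA; exact: expR_gt0.
by rewrite -[A]expRK ler_ln ?posrE ?expR_gt0.
Unshelve. all: by end_near. Qed.

Lemma lt_limn_einf_near (u : nat -> R) (a b : R) : a < b ->
  limn_einf (fun n => (u n)%:E) = b%:E -> \forall n \near \oo, a <= u n.
Proof.
move=> ab; rewrite limn_einf_lim.
rewrite (_ : limn _ = ereal_sup (range (einfs (fun n => (u n)%:E)))); last first.
  by apply/cvg_lim => //; exact: cvg_einfs_sup.
move=> supE.
have : (a%:E < ereal_sup (range (einfs (fun n => (u n)%:E))))%E by rewrite supE lte_fin.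
move=> /ereal_sup_gt [_ [N _ <-] aN].
exists N => // n /= Nn; rewrite -lee_fin; apply: le_trans (ltW aN) _.
by apply: ereal_inf_lbound; exists n.
Qed.

End Asymptotics.

(** Hubs have weight at least [c0 * D]; the factor 1/4 puts the excluded degrees below
    half of the weight, where [degree_lower_tail] is exponentially small. *)
Definition concentrated_degrees (R : realType) (c0 eps D : R) (l n : nat) (g : graph n) : Prop :=
  forall i : 'I_n,
    if (i < l)%N
    then c0 / 4 * D <= degree R g i <= 4 * D
    else degree R g i <= eps * D.

Section Concentration.
Variables (R : realType) (w : nat -> nat -> R) (l : nat -> nat) (theta gamma c0 : R).

Hypothesis het : strongly_heterogeneous w l theta gamma c0.

Let admissible : admissible_weights w. Proof. by case: het => -[]. Qed.

Lemma weight_le_wmax n i : (1 <= i <= n)%N -> w n i <= wmax w n.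
Proof.
move=> /andP[i1 ni]; rewrite /wmax big_add1 /= big_mkord.
case: i i1 ni => // i _ ni.
exact: (le_bigmax _ (fun k : 'I_n => w n k.+1) (Ordinal ni)).
Qed.

Lemma wmax_gt0 n : (1 <= n)%N -> 0 < wmax w n.
Proof.
move=> n1; have [h _ _] := admissible n1.
by apply: lt_le_trans (weight_le_wmax (i := 1) _); rewrite ?h.
Qed.

Lemma wmax_le_size n : (1 <= n)%N -> wmax w n <= n%:R.
Proof.
move=> n1; have [_ _ wsq] := admissible n1; have w0 := wmax_gt0 n1.
rewrite -(ler_pM2r w0) -expr2; apply: le_trans wsq _.
rewrite /wsum big_add1 /= big_mkord mulr_natl -[n in _ *+ n]card_ord -sumr_const.
by apply: ler_sum => i _; apply: weight_le_wmax; rewrite ltn_ord.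
Qed.

(** Since [wmax w n <= n], the number of hubs is of order at most [n `^ theta]. *)
Lemma near_hubs_lt_size : \forall n \near \oo, (l n < n)%N.
Proof.
case: het => -[_ /andP[t0 t1] _] _ [G0 [G00 lG]] _ _.
have [B B0 HB] := sublinear_powR_eventually G0 t1.
near=> n; have n1 : (1 <= n)%N by near: n; exact: nbhs_infty_ge.
rewrite ltnNge; apply/negP => nl.
have := lG n n1; apply/negP; rewrite -leNgt.
apply: (@le_trans _ _ n%:R); last by rewrite ler_nat.
apply: (@le_trans _ _ (G0 * n%:R `^ theta)); last by apply: HB; near: n; exact: nbhs_infty_ger.
rewrite ler_wpM2l ?(ltW G00) // ge0_ler_powR ?nnegrE ?ler0n ?wmax_le_size //; first exact: ltW.
by rewrite ltW // wmax_gt0.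
Unshelve. all: by end_near. Qed.

(** Node [n] is eventually not a hub, so its weight, which bounds [wmax w n] from below,
    is at least a constant times [ln n `^ (1 + beta)] for some [beta > 0]. *)
Lemma near_log_le_wmax (A : R) : \forall n \near \oo, A * ln n%:R <= wmax w n.
Proof.
case: (het) => _ _ _ _ [G1 [G2 [b [G10 G20 b0 Hw]]]].
have [B B0 HB] := powR_ge_eventually (A / G1) b0.
near=> n; have n1 : (1 <= n)%N by near: n; exact: nbhs_infty_ge.
have ln_n : (l n < n)%N by near: n; exact: near_hubs_lt_size.
have Bn : B <= ln n%:R by near: n; exact: near_ln_ge.
have lnn0 : 0 < ln n%:R :> R by apply: lt_le_trans Bn.
have [|/ltW h _] := Hw n n n1; first by rewrite ln_n leqnn.
apply: le_trans (weight_le_wmax (i := n) _); last by rewrite n1 leqnn.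
apply: le_trans h; rewrite powRD; last by rewrite (gt_eqF lnn0) implybT.
rewrite powRr1 ?(ltW lnn0) // [G1 * _]mulrA mulrAC [G1 * _]mulrC ler_wpM2r ?(ltW lnn0) //.
by rewrite -ler_pdivrMr // HB.
Unshelve. all: by end_near. Qed.

Lemma near_wmax_ge (A : R) : \forall n \near \oo, A <= wmax w n.
Proof.
near=> n; apply: (@le_trans _ _ (`|A| * ln n%:R)); last by near: n; exact: near_log_le_wmax.
apply: le_trans (ler_norm A) _; rewrite -[leLHS]mulr1 ler_wpM2l //.
by near: n; exact: near_ln_ge.
Unshelve. all: by end_near. Qed.

Lemma near_few_hubs (eps : R) : 0 < eps -> \forall n \near \oo, (l n)%:R <= eps * wmax w n.
Proof.
move=> e0; case: (het) => -[_ /andP[t0 t1] _] _ [G0 [G00 lG]] _ _.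
have [B B0 HB] := sublinear_powR_eventually (G0 / eps) t1.
near=> n; have n1 : (1 <= n)%N by near: n; exact: nbhs_infty_ge.
apply: le_trans (ltW (lG n n1)) _.
rewrite -ler_pdivrMl // mulrA [_^-1 * _]mulrC.
by apply: HB; near: n; exact: near_wmax_ge.
Unshelve. all: by end_near. Qed.

Lemma near_low_weights (eps : R) : 0 < eps ->
  \forall n \near \oo, forall i, (l n < i <= n)%N -> w n i <= eps * wmax w n.
Proof.
move=> e0; case: (het) => -[_ _ /andP[g0 g1]] _ _ _ [G1 [G2 [b [G10 G20 b0 Hw]]]].
have [|B B0 HB] := @sublinear_powR_eventually R (1 - gamma) (G2 / eps).
  by rewrite ltrBlDr ltrDl.
near=> n; have n1 : (1 <= n)%N by near: n; exact: nbhs_infty_ge.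
move=> i li; have [_ /ltW h] := Hw n i n1 li; apply: le_trans h _.
rewrite -ler_pdivrMl // mulrA [_^-1 * _]mulrC.
by apply: HB; near: n; exact: near_wmax_ge.
Unshelve. all: by end_near. Qed.

Lemma near_hub_weights :
  \forall n \near \oo, forall i, (1 <= i <= l n)%N -> c0 * wmax w n <= w n i.
Proof.
case: (het) => _ _ _ [/andP[c00 _] Hlim] _.
have c02 : c0 < 2 * c0 by lra.
near=> n; have n1 : (1 <= n)%N by near: n; exact: nbhs_infty_ge.
have ln_n : (l n < n)%N by near: n; exact: near_hubs_lt_size.
have h : c0 <= w n (l n) / wmax w n.
  by near: n; exact: (lt_limn_einf_near c02 Hlim).
move=> i /andP[i1 il]; have [_ mono _] := admissible n1.
apply: le_trans (mono i (l n) i1 il (ltnW ln_n)).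
by rewrite -ler_pdivlMr // wmax_gt0.
Unshelve. all: by end_near. Qed.

(** Each of the [n] nodes violates its bounds with probability at most
    [2 * expR (- k * wmax w n)], which is at most [2 / n ^+ 2] by [near_log_le_wmax]. *)
Lemma almost_every_graph_concentrated (eps : R) : 0 < eps ->
  almost_every_graph w (fun n => [set g | concentrated_degrees c0 eps (wmax w n) (l n) g]).
Proof.
move=> e0; have c00 : 0 < c0 by case: (het) => _ _ _ [/andP[]].
pose k := Num.min (Num.min (c0 / 4) (eps / 4)) 1.
have k0 : 0 < k by rewrite !lt_min !divr_gt0 ?ltr01.
have k1 : k <= c0 / 4 by rewrite !ge_min lexx.
have k2 : k <= eps / 4 by rewrite !ge_min lexx orbT.
have k3 : k <= 1 by rewrite !ge_min lexx orbT.
have e40 : 0 < eps / 4 by rewrite divr_gt0.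
have lower_cvg : (1 - 4 * harmonic n : R) @[n --> \oo] --> (1 : R).
  rewrite -[X in _ --> X]subr0 -[X in 1 - X](mulr0 4).
  apply: cvgB; first exact: cvg_cst.
  by apply: cvgM; [exact: cvg_cst|exact: cvg_harmonic].
apply: (squeeze_cvgr _ lower_cvg (cvg_cst (1 : R))).
near=> n; have n1 : (1 <= n)%N by near: n; exact: nbhs_infty_ge.
have [hw mono wsq] := admissible n1.
have hle i : (1 <= i <= n)%N -> w n i <= wmax w n by apply: weight_le_wmax.
have W0 := wmax_gt0 n1.
rewrite (graph_prob_le1 n1 hw hle wsq) andbT.
pose B (i : 'I_n) : set (graph n) := if (i < l n)%N then
    [set g | degree R g i < c0 / 4 * wmax w n] `|` [set g | 4 * wmax w n < degree R g i]
  else [set g | eps * wmax w n < degree R g i].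
apply: (@le_trans _ _ (graph_prob w [set g | forall i, ~ B i g])); last first.
  apply: (graph_prob_sub n1 hw hle wsq) => g /= H i; have := H i; rewrite /B.
  case: ifP => _ /=; last by move/negP; rewrite -leNgt.
  by move=> /not_orP[/negP + /negP]; rewrite -!leNgt => -> ->.
apply: le_trans (graph_prob_union_bound n1 hw hle wsq B); rewrite lerD2l lerN2.
have kW : 2 * ln n%:R <= k * wmax w n.
  by rewrite -ler_pdivrMl // mulrA; near: n; exact: near_log_le_wmax.
have hub : forall i, (1 <= i <= l n)%N -> c0 * wmax w n <= w n i.
  by near: n; exact: near_hub_weights.
have low : forall i, (l n < i <= n)%N -> w n i <= eps / 4 * wmax w n.
  by near: n; exact: near_low_weights.
have tail (a : R) : a <= - (k * wmax w n) -> expR a <= n%:R^-1 ^+ 2.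
  move=> ak; have n0 : (0 : R) < n%:R by rewrite ltr0n.
  rewrite exprVn -[X in X^-1]lnK ?posrE ?exprn_gt0 // lnXn // -expRN ler_expR.
  by rewrite -[ln _ *+ 2]mulr_natl; lra.
have Bi i : graph_prob w (B i) <= 2 * n%:R^-1 ^+ 2.
  have n20 : 0 <= n%:R^-1 ^+ 2 :> R by rewrite exprn_ge0 // invr_ge0.
  have si : (1 <= i.+1 <= n)%N by rewrite ltn_ord.
  have kc : k * wmax w n <= c0 / 4 * wmax w n by rewrite ler_wpM2r // ltW.
  have ke : k * wmax w n <= eps / 4 * wmax w n by rewrite ler_wpM2r // ltW.
  have k1' : k * wmax w n <= wmax w n by rewrite ler_piMl // ltW.
  rewrite /B; case: ifP => il.
    apply: le_trans (graph_probU n1 hw hle wsq _ _) _.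
    have -> : 2 * n%:R^-1 ^+ 2 = n%:R^-1 ^+ 2 + n%:R^-1 ^+ 2 :> R by ring.
    apply: lerD.
      apply: le_trans (degree_lower_tail n1 hw hle wsq _ _) (tail _ _).
      have := hub i.+1; rewrite ltnS il => /(_ isT); lra.
    apply: le_trans (degree_upper_tail n1 hw hle wsq _ _) (tail _ _).
    have := hle i.+1 si; lra.
  apply: (@le_trans _ _ (n%:R^-1 ^+ 2)); last by rewrite ler_peMl // ler1n.
  apply: le_trans (degree_upper_tail n1 hw hle wsq _ _) (tail _ _).
  have := low i.+1; rewrite ltnS leqNgt il ltn_ord => /(_ isT); lra.
apply: le_trans (ler_sum _ (fun i _ => Bi i)) _.
rewrite sumr_const card_ord -[_ *+ n]mulr_natl.
have n0 : (0 : R) < n%:R by rewrite ltr0n.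
have -> : n%:R * (2 * n%:R^-1 ^+ 2) = 2 / n%:R :> R by field; rewrite gt_eqF.
rewrite ler_pdivrMr // mulrAC ler_pdivlMr ?ltr0n //.
have : (1 : R) <= n%:R by rewrite ler1n.
by rewrite -natr1; lra.
Unshelve. all: by end_near.
Qed.

End Concentration.

(** * Block vectors and the Schur test *)

Section Coercivity.
Variable R : realType.

(** Apply the Cauchy-Schwarz inequality of the form [H] to [x] and [invmx H *m x]: it
    bounds [dot x x ^+ 2] by [dot x (H *m x)] times a multiple of [dot x x]. *)
Lemma posdef_coercive d (H : 'M[R]_d) : posdef H ->
  exists2 lambda, 0 < lambda & forall x, lambda * dot x x <= dot x (H *m x).
Proof.
move=> [Ht Hp].
have Hge x : 0 <= form H x x.
  have [->|x0] := eqVneq x 0; first by rewrite /form mulmx0 mxE.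
  exact/ltW/Hp.
have Hu : H \in unitmx.
  rewrite -row_free_unit -kermx_eq0; apply/eqP/row_matrixP => i.
  rewrite row0; set r := row i _.
  have rH : r *m H = 0 by apply/eqP; rewrite -sub_kermx row_sub.
  apply/eqP; apply: contraT => r0.
  have := Hp r^T; rewrite trmxK rH mul0mx mxE ltxx; apply.
  by apply: contra_neq r0 => /(congr1 trmx); rewrite trmxK trmx0.
have [k k0 Hk] := exists_mulmx_bound (invmx H).
exists (k + 1)^-1 => [|x]; first by rewrite invr_gt0 ltr_wpDl.
have := form_cauchy_schwarz x (invmx H *m x) Ht Hge.
rewrite !form_dot mulmxA mulmxV // mul1mx.
have yx : dot (invmx H *m x) x <= k * dot x x.
  apply: le_trans (dot_le _ _) _; rewrite -sqr_enorm expr2 mulrA.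
  by rewrite ler_wpM2r ?enorm_ge0 // Hk.
have Hx : 0 <= dot x (H *m x) by rewrite -form_dot Hge.
have [->|x0] := eqVneq (dot x x) 0; first by rewrite mulr0.
have xp : 0 < dot x x by rewrite lt_def x0 dot_ge0.
move=> h; rewrite ler_pdivrMl ?ltr_wpDl //.
have := le_trans h (ler_wpM2l Hx yx); rewrite expr2 mulrA ler_pM2r // => h2.
by apply: le_trans h2 _; rewrite mulrC ler_wpM2r // lerDl.
Qed.

End Coercivity.

Section Blocks.
Variables (R : realType) (n d : nat).

(** A vector of ['cV_(n * d)] is a family of [n] vectors of ['cV_d], in the indexing of
    the Kronecker product. *)
Definition block (i : 'I_n) (x : 'cV[R]_(n * d)) : 'cV[R]_d :=
  \col_k x (mxtens_index (i, k)) 0.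

Definition unblock (f : 'I_n -> 'cV[R]_d) : 'cV[R]_(n * d) :=
  \col_q f (mxtens_unindex q).1 (mxtens_unindex q).2 0.

Lemma unblockK f i : block i (unblock f) = f i.
Proof. by apply/matrixP => k o; rewrite !mxE mxtens_indexK ord1. Qed.

Lemma block_inj x y : (forall i, block i x = block i y) -> x = y.
Proof.
move=> xy; apply/matrixP => q o; rewrite ord1; case: (mxtens_indexP q) => i k.
by have /matrixP/(_ k 0) := xy i; rewrite !mxE.
Qed.

Lemma blockD i x y : block i (x + y) = block i x + block i y.
Proof. by apply/matrixP => k o; rewrite !mxE. Qed.

Lemma blockN i x : block i (- x) = - block i x.
Proof. by apply/matrixP => k o; rewrite !mxE. Qed.

Lemma blockZ i a x : block i (a *: x) = a *: block i x.
Proof. by apply/matrixP => k o; rewrite !mxE. Qed.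

Lemma sum_mxtens (F : 'I_(n * d) -> R) :
  \sum_q F q = \sum_(i < n) \sum_(k < d) F (mxtens_index (i, k)).
Proof.
rewrite pair_big /= (reindex (@mxtens_index n d)) /=.
  by apply: eq_bigr => -[].
by exists (@mxtens_unindex n d) => q _; [exact: mxtens_indexK|exact: mxtens_unindexK].
Qed.

Lemma dot_block x y : dot x y = \sum_i dot (block i x) (block i y).
Proof.
rewrite dotE sum_mxtens; apply: eq_bigr => i _.
by rewrite dotE; apply: eq_bigr => k _; rewrite !mxE.
Qed.

Lemma block_tens (A : 'M[R]_n) (B : 'M[R]_d) i x :
  block i ((A *t B) *m x) = \sum_j A i j *: (B *m block j x).
Proof.
apply/matrixP => k o; rewrite !mxE summxE sum_mxtens; apply: eq_bigr => j _.
rewrite !mxE mulr_sumr; apply: eq_bigr => l _.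
by rewrite tensmxE (ord1 o) mxE mulrA.
Qed.

Lemma enorm_block_le x y K : 0 <= K ->
  (forall i, enorm (block i x) <= K * enorm (block i y)) -> enorm x <= K * enorm y.
Proof.
move=> K0 H; rewrite enorm_le // !dot_block mulr_sumr; apply: ler_sum => i _.
by rewrite -enorm_le.
Qed.

Definition blockdiag (B : 'I_n -> 'M[R]_d) : 'M[R]_(n * d) :=
  \sum_i (delta_mx i i *t B i).

Lemma blockdiagE B i j k l :
  blockdiag B (mxtens_index (i, k)) (mxtens_index (j, l)) = (i == j)%:R * B i k l.
Proof.
rewrite summxE (bigD1 i) //= tensmxE mxE eqxx andTb eq_sym big1 ?addr0 // => a ai.
by rewrite tensmxE mxE eq_sym (negbTE ai) mul0r.
Qed.

Lemma block_blockdiag B i x : block i (blockdiag B *m x) = B i *m block i x.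
Proof.
apply/matrixP => k o; rewrite !mxE sum_mxtens (bigD1 i) //= [X in _ + X]big1 ?addr0.
  by apply: eq_bigr => l _; rewrite blockdiagE eqxx mul1r (ord1 o) mxE.
by move=> j ji; rewrite big1 // => l _; rewrite blockdiagE eq_sym (negbTE ji) !mul0r.
Qed.

Lemma eq_mulmx_col m (A B : 'M[R]_m) : (forall x : 'cV[R]_m, A *m x = B *m x) -> A = B.
Proof.
move=> AB; apply/matrixP => i j; have /matrixP/(_ i 0) := AB (delta_mx j 0).
by rewrite -!colE !mxE.
Qed.

Lemma blockdiag1 : blockdiag (fun=> 1%:M) = 1%:M.
Proof.
apply: eq_mulmx_col => x; apply: block_inj => i.
by rewrite block_blockdiag !mul1mx.
Qed.

Lemma blockdiagM B C : blockdiag B *m blockdiag C = blockdiag (fun i => B i *m C i).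
Proof.
apply: eq_mulmx_col => x; apply: block_inj => i.
by rewrite -mulmxA !block_blockdiag mulmxA.
Qed.

Lemma blockdiagN B : - blockdiag B = blockdiag (fun i => - B i).
Proof.
apply: eq_mulmx_col => x; apply: block_inj => i.
by rewrite mulNmx blockN !block_blockdiag mulNmx.
Qed.

Lemma is_derive_blockdiag (B : 'I_n -> R -> 'M[R]_d) dB (t : R) :
  (forall i, is_derive t 1 (B i) (dB i)) ->
  is_derive t 1 (fun u => blockdiag (B ^~ u)) (blockdiag dB).
Proof.
move=> HB; apply/is_derive_mxP => p q.
case: (mxtens_indexP p) => i k; case: (mxtens_indexP q) => j l.
rewrite blockdiagE (_ : (fun u => _) = fun u => (i == j)%:R * B i u k l); last first.
  by rewrite funeqE => u; rewrite blockdiagE.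
have /is_derive_mxP/(_ k l) D := HB i.
have := is_derive_mulf (is_derive_cst ((i == j)%:R : R) t (1 : R)) D.
by rewrite mul0r add0r.
Qed.

Lemma fundamental_pair_blockdiag (V X Y : 'I_n -> R -> 'M[R]_d) :
  (forall i, fundamental_pair (V i) (X i) (Y i)) ->
  fundamental_pair (fun t => blockdiag (V ^~ t)) (fun t => blockdiag (X ^~ t))
    (fun t => blockdiag (Y ^~ t)).
Proof.
move=> H; split=> [t|t|t|].
- by rewrite blockdiagM; apply: is_derive_blockdiag => i; case: (H i).
- by rewrite blockdiagM blockdiagN; apply: is_derive_blockdiag => i; case: (H i).
- rewrite blockdiagM -blockdiag1; congr blockdiag; rewrite funeqE => i.
  by case: (H i).
- by rewrite -blockdiag1; congr blockdiag; rewrite funeqE => i; case: (H i).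
Qed.

Lemma backward_contraction_blockdiag (X Y : 'I_n -> R -> 'M[R]_d) K0 eta0 :
  0 <= K0 -> (forall i, backward_contraction (X i) (Y i) K0 eta0) ->
  backward_contraction (fun t => blockdiag (X ^~ t)) (fun t => blockdiag (Y ^~ t)) K0 eta0.
Proof.
move=> K00 H t s v st; apply: enorm_block_le => [|i]; first by rewrite mulr_ge0 ?expR_ge0.
by rewrite !block_blockdiag; apply: H.
Qed.

(** The coordinates of the first [l] blocks are the first [d * l] coordinates. *)
Lemma block_pid_mx l i x : block i (pid_mx (d * l) *m x) = (i < l)%N%:R *: block i x.
Proof.
apply/matrixP => k o; have kd := ltn_ord k.
have key : (i * d + k < d * l)%N = (i < l)%N.
  rewrite [(d * l)%N]mulnC; case: (ltnP i l) => il.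
    by rewrite (@leq_trans (i.+1 * d)) ?leq_mul2r ?il ?orbT // mulSn addnC ltn_add2r.
  by apply/negbTE; rewrite -leqNgt (@leq_trans (i * d)) ?leq_addr // leq_mul2r il orbT.
rewrite !mxE (bigD1 (mxtens_index (i, k))) //= [X in _ + X]big1 ?addr0.
  by rewrite mxE eqxx /= key.
by move=> q qi; rewrite mxE eq_sym (inj_eq val_inj) (negbTE qi) mul0r.
Qed.

End Blocks.

Lemma sum_weighted_sqr (R : realType) n (a y : 'I_n -> R) :
  (forall j, a j ^+ 2 = a j) ->
  (\sum_j a j * y j) ^+ 2 <= (\sum_j a j) * \sum_j a j * y j ^+ 2.
Proof.
move=> a2.
pose u : 'cV[R]_n := \col_j a j; pose v : 'cV[R]_n := \col_j (a j * y j).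
have := sqr_dot_le u v.
have -> : dot u v = \sum_j a j * y j.
  by rewrite dotE; apply: eq_bigr => j _; rewrite !mxE mulrA -expr2 a2.
have -> : dot u u = \sum_j a j.
  by rewrite dotE; apply: eq_bigr => j _; rewrite !mxE -expr2 a2.
suff -> : dot v v = \sum_j a j * y j ^+ 2 by [].
by rewrite dot_sqr; apply: eq_bigr => j _; rewrite !mxE exprMn a2.
Qed.

Lemma enorm_sum (R : realType) d (I : finType) (F : I -> 'cV[R]_d) :
  enorm (\sum_i F i) <= \sum_i enorm (F i).
Proof.
elim/big_ind2 : _ => [|x x' y y' xx yy|//]; first by rewrite enorm0.
exact: le_trans (enormD _ _) (lerD xx yy).
Qed.

(** Schur test for the rows in [p] of a 0-1 matrix: a block with row sums at most [r]
    and column sums at most [c] has norm at most [sqrt (r * c)].  Unbalanced blocks,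
    with few hubs or with low degrees on one side, are therefore small. *)
Lemma schur_test (R : realType) n d (A : 'M[R]_n) (p : pred 'I_n) (r c : R)
    (u : 'cV[R]_(n * d)) :
  (forall i j, A i j ^+ 2 = A i j) -> 0 <= r ->
  (forall i, p i -> \sum_j A i j <= r) ->
  (forall j, \sum_(i | p i) A i j <= c) ->
  enorm (unblock (fun i => if p i then \sum_j A i j *: block j u else 0))
    <= Num.sqrt (r * c) * enorm u.
Proof.
move=> A2 r0 rowA colA.
have A0 i j : 0 <= A i j by rewrite -A2 sqr_ge0.
have c0 : (0 < n)%N -> 0 <= c.
  by move=> n0; apply: le_trans (colA (Ordinal n0)); apply: sumr_ge0.
rewrite enorm_le ?sqrtr_ge0 //.
case: (posnP n) => [n0|/c0 {}c0].
  by rewrite !dot_block !big1 ?mulr0 // => i _; have := ltn_ord i; rewrite [X in (_ < X)%N]n0.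
rewrite sqr_sqrtr ?mulr_ge0 // !dot_block.
apply: (@le_trans _ _ (\sum_(i | p i) r * \sum_j A i j * dot (block j u) (block j u))).
  rewrite [leRHS]big_mkcond; apply: ler_sum => i _; rewrite unblockK.
  case: ifP => pi; last by rewrite dot0r.
  have s0 : 0 <= \sum_j A i j * dot (block j u) (block j u).
    by apply: sumr_ge0 => j _; rewrite mulr_ge0 // dot_ge0.
  apply: le_trans (ler_wpM2r s0 (rowA i pi)).
  under [X in _ <= _ * X]eq_bigr do rewrite -sqr_enorm.
  apply: le_trans (sum_weighted_sqr _ (A2 i)).
  rewrite -sqr_enorm ler_pXn2r ?nnegrE ?enorm_ge0 //; last first.
    by apply: sumr_ge0 => j _; rewrite mulr_ge0 // enorm_ge0.
  apply: le_trans (enorm_sum _) _; apply: ler_sum => j _.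
  by rewrite enormZ ger0_norm.
rewrite -mulr_sumr -mulrA ler_wpM2l // exchange_big /= mulr_sumr.
by apply: ler_sum => j _; rewrite -mulr_suml ler_wpM2r // dot_ge0.
Qed.

(** * Graphs with concentrated degrees *)

Section ConcentratedGraph.
Variables (R : realType) (n d l : nat) (H : 'M[R]_d) (V : nat -> R -> 'M[R]_d).
Variables (g : graph n) (nH lambda M c0 alpha0 D eta delta : R).
Hypotheses (nH0 : 0 <= nH) (HnH : forall v : 'cV[R]_d, enorm (H *m v) <= nH * enorm v).
Hypotheses (lambda0 : 0 < lambda)
  (Hlambda : forall v : 'cV[R]_d, lambda * dot v v <= dot v (H *m v)).
Hypotheses (M0 : 0 <= M)
  (VM : forall i (t : R) (v : 'cV[R]_d), (1 <= i)%N -> 0 < t -> enorm (V i t *m v) <= M * enorm v).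
Hypotheses (D0 : 0 < D) (alpha00 : 0 < alpha0) (c00 : 0 < c0).
Hypotheses (eta0 : 0 < eta) (eta1 : eta <= 1).
Hypotheses (ln : (l <= n)%N) (few_hubs : l%:R <= eta ^+ 2 * D).
Hypothesis degrees : concentrated_degrees c0 (eta ^+ 2) D l g.
Hypothesis strong : M + 1 <= alpha0 * (c0 / 4) * lambda.
Hypothesis small : 3 * alpha0 * nH * eta <= delta.

Let A : 'M[R]_n := adjacency R g.
Let alpha := alpha0 / D.
Let hub (i : 'I_n) := (i < l)%N.
Let kappa (i : 'I_n) : R := \sum_j A i j.
Let Pi : 'M[R]_(n * d) := pid_mx (d * l).

Let A_sqr i j : A i j ^+ 2 = A i j.
Proof. by rewrite mxE; case: (val g i j); rewrite ?expr1n ?expr0n. Qed.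

Let A_ge0 i j : 0 <= A i j.
Proof. by rewrite -A_sqr sqr_ge0. Qed.

Let A_le1 i j : A i j <= 1.
Proof. by rewrite mxE; case: (val g i j); rewrite ?ler01. Qed.

Let A_sym i j : A i j = A j i.
Proof. by have /eqP/matrixP/(_ j i) := valP g; rewrite !mxE => ->. Qed.

Let kappa_ge0 i : 0 <= kappa i.
Proof. by apply: sumr_ge0. Qed.

Let eta_sqr : eta ^+ 2 <= eta.
Proof. by rewrite expr2 ler_piMr // ltW. Qed.

Let kappa_hub i : hub i -> c0 / 4 * D <= kappa i <= 4 * D.
Proof. by move=> hi; have := degrees i; rewrite -/(hub i) hi. Qed.

Let kappa_low i : ~~ hub i -> kappa i <= eta ^+ 2 * D.
Proof. by move=> hi; have := degrees i; rewrite -/(hub i) (negbTE hi). Qed.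

Let kappa_le i : kappa i <= 4 * D.
Proof.
case: (boolP (hub i)) => [/kappa_hub/andP[]//|/kappa_low h].
apply: le_trans h _; rewrite ler_wpM2r ?(ltW D0) //.
by apply: le_trans eta_sqr _; apply: le_trans eta1 _; rewrite ler1n.
Qed.

Let column_hub j : \sum_(i | hub i) A i j <= l%:R.
Proof.
apply: (@le_trans _ _ (\sum_(i < n | hub i) 1)); first exact: ler_sum.
by rewrite /hub -(big_ord_widen n (fun=> 1) ln) sumr_const card_ord.
Qed.

Let column_le (p : pred 'I_n) j : \sum_(i | p i) A i j <= 4 * D.
Proof.
apply: le_trans (kappa_le j); rewrite /kappa big_mkcond; apply: ler_sum => i _.
by rewrite A_sym; case: ifP.
Qed.

Section Vector.
Variable x : 'cV[R]_(n * d).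

Let Hx : 'cV[R]_(n * d) := unblock (fun i => H *m block i x).

Let Hx_le : enorm Hx <= nH * enorm x.
Proof. by apply: enorm_block_le => // i; rewrite unblockK. Qed.

(** The Laplacian term of the field is [outflow - inflow]: the degree part and the
    adjacency part, here restricted to the nodes of [p]. *)
Let inflow (p : pred 'I_n) : 'cV[R]_(n * d) :=
  unblock (fun i => if p i then \sum_j A i j *: block j Hx else 0).

Let outflow (p : pred 'I_n) : 'cV[R]_(n * d) :=
  unblock (fun i => if p i then kappa i *: (H *m block i x) else 0).

Let block_field i t : block i (coupled_field H V alpha g t *m x) =
  V i.+1 t *m block i x - alpha *: (kappa i *: (H *m block i x) - \sum_j A i j *: block j Hx).
Proof.
rewrite /coupled_field mulmxBl blockD blockN -scalemxAl blockZ.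
rewrite (block_blockdiag (fun i => V i.+1 t)) block_tens; congr (_ - _ *: _).
rewrite (eq_bigr (fun j => ((i == j)%:R * kappa i) *: (H *m block j x) - A i j *: block j Hx)).
  rewrite sumrB (bigD1 i) //= eqxx mul1r big1 ?addr0 // => j ji.
  by rewrite eq_sym (negbTE ji) mul0r scale0r.
move=> j _; rewrite unblockK -scalerBl mxE; congr (_ *: _).
Qed.

Let inflow_le (p : pred 'I_n) (r c b : R) : 0 <= b -> 0 <= r ->
  (forall i, p i -> kappa i <= r) -> (forall j, \sum_(i | p i) A i j <= c) ->
  r * c <= b ^+ 2 -> enorm (inflow p) <= b * nH * enorm x.
Proof.
move=> b0 r0 rows cols rcb.
apply: le_trans (schur_test Hx A_sqr r0 rows cols) _; rewrite -mulrA.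
apply: ler_pM; rewrite ?sqrtr_ge0 ?enorm_ge0 //.
by rewrite -[leRHS]ger0_norm // -sqrtr_sqr ler_wsqrtr.
Qed.

Let outflow_le (p : pred 'I_n) (b : R) : 0 <= b ->
  (forall i, p i -> kappa i <= b) -> enorm (outflow p) <= b * nH * enorm x.
Proof.
move=> b0 pb; apply: enorm_block_le => [|i]; first exact: mulr_ge0.
rewrite unblockK; case: ifP => [/pb kb|_]; last first.
  by rewrite enorm0 !mulr_ge0 // enorm_ge0.
rewrite enormZ ger0_norm // -mulrA; apply: ler_pM => //; exact: enorm_ge0.
Qed.

Let alphaD : alpha * D = alpha0.
Proof. by rewrite /alpha divfK // gt_eqF. Qed.

Let alpha_gt0 : 0 < alpha.
Proof. exact: divr_gt0. Qed.

Let nHx0 : 0 <= nH * enorm x.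
Proof. by rewrite mulr_ge0 // enorm_ge0. Qed.

(** Up to the factor [alpha = alpha0 / D], degrees and adjacency have norm at most
    [4 * D], which leaves a bound independent of the graph. *)
Let field_bound t : 0 < t ->
  enorm (coupled_field H V alpha g t *m x) <= (M + 8 * alpha0 * nH) * enorm x.
Proof.
move=> t0.
have -> : coupled_field H V alpha g t *m x =
    blockdiag (fun i : 'I_n => V i.+1 t) *m x - alpha *: (outflow xpredT - inflow xpredT).
  apply: block_inj => i; rewrite block_field blockD blockN blockZ block_blockdiag.
  by rewrite blockD blockN !unblockK.
have h1 : enorm (blockdiag (fun i : 'I_n => V i.+1 t) *m x) <= M * enorm x.
  by apply: enorm_block_le => // i; rewrite block_blockdiag VM.
have D40 : 0 <= 4 * D by rewrite mulr_ge0 // ltW.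
have h2 : enorm (outflow xpredT) <= 4 * D * nH * enorm x by apply: outflow_le.
have h3 : enorm (inflow xpredT) <= 4 * D * nH * enorm x.
  by apply: (@inflow_le _ (4 * D) (4 * D)) => //; rewrite ?expr2.
apply: le_trans (enormB _ _) _; rewrite enormZ gtr0_norm //.
have h4 : alpha * enorm (outflow xpredT - inflow xpredT) <= alpha * (8 * D * nH * enorm x).
  by rewrite ler_wpM2l ?(ltW alpha_gt0) //; apply: le_trans (enormB _ _) _; lra.
have -> : (M + 8 * alpha0 * nH) * enorm x = M * enorm x + alpha * (8 * D * nH * enorm x).
  by rewrite -alphaD; ring.
exact: lerD.
Qed.

(** The degree of a hub is of order [D], so its own coupling term beats [M]; what hubs
    receive is small since there are few of them: the block has row sums at most
    [4 * D] and column sums at most [eta ^+ 2 * D]. *)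
Let hub_dissipation t : 0 < t ->
  dot (Pi *m x) (coupled_field H V alpha g t *m x) <=
  - dot (Pi *m x) (Pi *m x) + delta * enorm x * enorm (Pi *m x).
Proof.
move=> t0.
have splitE : dot (Pi *m x) (coupled_field H V alpha g t *m x) =
    \sum_i (hub i)%:R * (dot (block i x) (V i.+1 t *m block i x)
       - alpha * kappa i * dot (block i x) (H *m block i x))
    + alpha * dot (Pi *m x) (inflow hub).
  rewrite !dot_block mulr_sumr -big_split /=; apply: eq_bigr => i _.
  rewrite block_field block_pid_mx unblockK -/(hub i) !dotZl.
  case: (hub i); last by rewrite !mul0r mulr0 addr0.
  by rewrite !mul1r !dotBr !dotZr dotBr !dotZr; ring.
have PixE : dot (Pi *m x) (Pi *m x) = \sum_i (hub i)%:R * dot (block i x) (block i x).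
  rewrite dot_block; apply: eq_bigr => i _.
  by rewrite block_pid_mx dotZl dotZr -/(hub i); case: (hub i); rewrite ?mul1r ?mul0r.
rewrite splitE; apply: lerD.
  rewrite PixE -sumrN; apply: ler_sum => i _; case: (boolP (hub i)) => hi; last first.
    by rewrite !mul0r oppr0.
  rewrite !mul1r.
  have h1 : dot (block i x) (V i.+1 t *m block i x) <= M * dot (block i x) (block i x).
    apply: le_trans (dot_le _ _) _; rewrite -sqr_enorm expr2 mulrCA ler_wpM2l ?enorm_ge0 //.
    exact: VM.
  have d0 := dot_ge0 (block i x).
  have [k1 _] := andP (kappa_hub hi).
  have h2 : alpha0 * (c0 / 4) <= alpha * kappa i.
    have -> : alpha0 * (c0 / 4) = alpha * (c0 / 4 * D) by rewrite -alphaD; ring.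
    by rewrite ler_wpM2l // ltW.
  have h3 : (M + 1) * dot (block i x) (block i x)
      <= alpha0 * (c0 / 4) * lambda * dot (block i x) (block i x) by rewrite ler_wpM2r.
  have h4 : alpha0 * (c0 / 4) * lambda * dot (block i x) (block i x)
      <= alpha * kappa i * dot (block i x) (H *m block i x).
    rewrite -mulrA; apply: ler_pM => //; rewrite mulr_ge0 ?divr_ge0 // ltW //.
  lra.
have h : enorm (inflow hub) <= 2 * eta * D * nH * enorm x.
  apply: (@inflow_le _ (4 * D) l%:R) => //; rewrite ?mulr_ge0 ?(ltW eta0) ?(ltW D0) //.
  have -> : (2 * eta * D) ^+ 2 = 4 * D * (eta ^+ 2 * D) by ring.
  by rewrite ler_wpM2l // mulr_ge0 // ltW.
apply: le_trans (ler_wpM2l (ltW alpha_gt0) (dot_le _ _)) _.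
rewrite [enorm (Pi *m x) * _]mulrC mulrA ler_wpM2r ?enorm_ge0 //.
apply: le_trans (ler_wpM2l (ltW alpha_gt0) h) _.
apply: (@le_trans _ _ (3 * alpha0 * nH * eta * enorm x)); last by rewrite ler_wpM2r ?enorm_ge0.
have -> : alpha * (2 * eta * D * nH * enorm x) = 2 * (alpha0 * eta * (nH * enorm x)).
  by rewrite -alphaD; ring.
have : 0 <= alpha0 * eta * (nH * enorm x) by rewrite mulr_ge0 // mulr_ge0 // ltW.
lra.
Qed.

(** Low nodes have degree at most [eta ^+ 2 * D], which bounds both their own term and
    the row sums of their adjacency block. *)
Let low_coupling t : 0 < t ->
  enorm ((1%:M - Pi) *m (coupled_field H V alpha g t *m x)
    - blockdiag (fun i : 'I_n => V i.+1 t) *m ((1%:M - Pi) *m x)) <= delta * enorm x.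
Proof.
move=> t0; pose low i := ~~ hub i.
have -> : (1%:M - Pi) *m (coupled_field H V alpha g t *m x)
    - blockdiag (fun i : 'I_n => V i.+1 t) *m ((1%:M - Pi) *m x) =
    - (alpha *: (outflow low - inflow low)).
  have complement (y : 'cV[R]_(n * d)) : (1%:M - Pi) *m y = y - Pi *m y.
    by rewrite mulmxBl mul1mx.
  apply: block_inj => i; rewrite !complement blockD !blockN block_blockdiag blockZ.
  rewrite !blockD !blockN !block_pid_mx block_field !unblockK -/(hub i) /low.
  case: (hub i) => /=; rewrite ?scale1r ?scale0r ?subr0.
    by rewrite !subrr mulmx0 subr0 scaler0 oppr0.
  by rewrite addrAC subrr add0r.
have eD0 : 0 <= eta * D by rewrite mulr_ge0 // ltW.
have h1 : enorm (outflow low) <= eta * D * nH * enorm x.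
  apply: outflow_le => // i /kappa_low h; apply: le_trans h _.
  by rewrite ler_wpM2r // ltW.
have h2 : enorm (inflow low) <= 2 * eta * D * nH * enorm x.
  apply: (@inflow_le _ (eta ^+ 2 * D) (4 * D)) => //;
    rewrite ?mulr_ge0 ?(ltW eta0) ?(ltW D0) ?exprn_ge0 //.
  by rewrite le_eqVlt; apply/orP; left; apply/eqP; ring.
rewrite enormN enormZ gtr0_norm //.
apply: (@le_trans _ _ (3 * alpha0 * nH * eta * enorm x)); last by rewrite ler_wpM2r ?enorm_ge0.
have -> : 3 * alpha0 * nH * eta * enorm x = alpha * (3 * eta * D * nH * enorm x).
  by rewrite -alphaD; ring.
by rewrite ler_wpM2l ?(ltW alpha_gt0) //; apply: le_trans (enormB _ _) _; lra.
Qed.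

Lemma nearly_decoupled_vector t : 0 < t ->
  [/\ enorm (coupled_field H V alpha g t *m x) <= (M + 8 * alpha0 * nH) * enorm x,
      dot (Pi *m x) (coupled_field H V alpha g t *m x) <=
        - dot (Pi *m x) (Pi *m x) + delta * enorm x * enorm (Pi *m x) &
      enorm ((1%:M - Pi) *m (coupled_field H V alpha g t *m x)
        - blockdiag (fun i : 'I_n => V i.+1 t) *m ((1%:M - Pi) *m x)) <= delta * enorm x].
Proof. by move=> t0; split; [apply: field_bound|apply: hub_dissipation|apply: low_coupling]. Qed.

End Vector.

Lemma nearly_decoupled_concentrated :
  nearly_decoupled Pi (fun t => blockdiag (fun i : 'I_n => V i.+1 t))
    (coupled_field H V alpha g) (M + 8 * alpha0 * nH) delta.
Proof. by move=> t x; apply: nearly_decoupled_vector. Qed.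

End ConcentratedGraph.

(** * Dichotomy of the coupled equations *)

Section Assembly.
Variable R : realType.

Lemma entry_continuous m (W : R -> 'M[R]_m) : continuous W ->
  forall i j, continuous (fun t => W t i j).
Proof.
move=> Wc i j t; exact: (continuous_comp (Wc t) (@coord_continuous _ _ _ i j (W t))).
Qed.

Lemma bounded_fields_enorm d (V : nat -> R -> 'M[R]_d) M i t v :
  bounded_fields V M -> (1 <= i)%N -> 0 < t -> enorm (V i t *m v) <= M * enorm v.
Proof.
move=> [_ VB VM] i1 t0; apply: le_trans (enorm_mulmx _ _) _.
rewrite ler_wpM2r ?enorm_ge0 //.
have [B HB] := VB i i1.
apply: (@le_trans _ _ (fnorm (V i))).
  by apply: ub_le_sup; [exists B => _ [u _ <-]|exists t].
rewrite -lee_fin -VM; apply: ereal_sup_ubound; by exists i.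
Qed.

Lemma fundamental_pair_of_bounded_fields d (V : nat -> R -> 'M[R]_d) M i :
  bounded_fields V M -> (1 <= i)%N -> exists X Y, fundamental_pair (V i) X Y.
Proof.
move=> [Vc VB _] i1; have [B HB] := VB i i1.
apply: (@exists_fundamental_pair _ _ (V i) B); first exact/entry_continuous/Vc.
move=> t; apply: enorm_mulmx_entry => x; apply: le_trans (enorm_mulmx _ _) _.
by rewrite ler_wpM2r ?enorm_ge0.
Qed.

Lemma backward_contraction_of_unstable d (V X Y : R -> 'M[R]_d) (T : R -> R -> 'M[R]_d)
    (K0 eta0 : R) :
  fundamental_pair V X Y -> evolution_operator V T ->
  (forall t s, s < t -> opnorm (invmx (T t s)) <= K0 * expR (- eta0 * (t - s))) ->
  backward_contraction X Y K0 eta0.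
Proof.
move=> [dX dY YX _] VT HT t s v st.
have TE := evolution_operator_fundamental dY YX VT t s.
have XY u : X u *m Y u = 1%:M by apply: mulmx1C.
have inv1 : (X s *m Y t) *m T t s = 1%:M.
  by rewrite TE -mulmxA [Y t *m _]mulmxA YX mul1mx XY.
have invE : invmx (T t s) = X s *m Y t.
  have [_ u2] := mulmx1_unit inv1.
  by rewrite -[LHS]mul1mx -inv1 mulmxK.
rewrite mulmxA -invE; apply: le_trans (enorm_mulmx _ _) _.
by rewrite ler_wpM2r ?enorm_ge0 // HT.
Qed.

Lemma coupled_fundamental_pair d (H : 'M[R]_d) (V : nat -> R -> 'M[R]_d) M alpha n
    (g : graph n) :
  bounded_fields V M -> exists X Y, fundamental_pair (coupled_field H V alpha g) X Y.
Proof.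
move=> [Vc VB _].
set Q := alpha *: (laplacian R g *t H).
have entryE t i k j l : coupled_field H V alpha g t (mxtens_index (i, k)) (mxtens_index (j, l))
    = (i == j)%:R * V i.+1 t k l - Q (mxtens_index (i, k)) (mxtens_index (j, l)).
  by rewrite mxE -/Q (blockdiagE (fun i : 'I_n => V i.+1 t)) [X in _ + X]mxE.
have /choice [B HB] : forall i : 'I_n, exists B : R, forall t, opnorm (V i.+1 t) <= B.
  by move=> i; apply: VB.
have VBe (i : 'I_n) t k l : `|V i.+1 t k l| <= B i.
  apply: le_trans (HB i t); apply: enorm_mulmx_entry => x; exact: enorm_mulmx.
have B0 i : 0 <= B i by apply: le_trans (opnorm_ge0 _) (HB i 0).
have Wc p q : continuous (fun t => coupled_field H V alpha g t p q).
  case: (mxtens_indexP p) => i k; case: (mxtens_indexP q) => j l.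
  rewrite (_ : (fun t => _) = fun t => (i == j)%:R * V i.+1 t k l
    - Q (mxtens_index (i, k)) (mxtens_index (j, l))); last first.
    by rewrite funeqE => t; exact: entryE.
  have c : continuous (fun t => V i.+1 t k l) by apply: entry_continuous; apply: Vc.
  move=> t; apply: cvgB; last exact: cvg_cst.
  by apply: cvgM; [exact: cvg_cst|exact: c].
have Wb t p q : `|coupled_field H V alpha g t p q| <= \sum_i B i + \sum_p \sum_q `|Q p q|.
  case: (mxtens_indexP p) => i k; case: (mxtens_indexP q) => j l; rewrite entryE.
  apply: le_trans (ler_normB _ _) _; apply: lerD.
    rewrite normrM (bigD1 i) //= -[leLHS]addr0; apply: lerD; last exact: sumr_ge0.
    rewrite -[leRHS]mul1r ler_pM //.
    by case: eqP => _; rewrite ?normr1 ?normr0.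
  rewrite (bigD1 (mxtens_index (i, k))) //= (bigD1 (mxtens_index (j, l))) //= -addrA lerDl.
  by apply: addr_ge0; apply: sumr_ge0 => // ? _; apply: sumr_ge0.
exact: exists_fundamental_pair Wc Wb.
Qed.

(** The threshold [delta] of [exists_coupling_threshold] translates into [eps = eta ^+ 2]:
    the Schur test takes the square root of [eps], and the coupling is at most
    [3 * alpha0 * opnorm H * eta]. *)
Lemma concentrated_dichotomy d (H : 'M[R]_d) (V : nat -> R -> 'M[R]_d)
    (M lambda c0 alpha0 : R) :
  0 < lambda -> (forall v, lambda * dot v v <= dot v (H *m v)) ->
  bounded_fields V M -> uniformly_unstable V ->
  0 < c0 -> 0 < alpha0 -> `|M| + 1 <= alpha0 * (c0 / 4) * lambda ->
  exists2 eps, 0 < eps & forall n l D (g : graph n), 0 < D -> (l <= n)%N ->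
    l%:R <= eps * D -> concentrated_degrees c0 eps D l g ->
    exponential_dichotomy (coupled_field H V (alpha0 / D) g) (d * l).
Proof.
move=> lambda0 Hlambda VM [eta0 [K0 [eta00 K00 Vu]]] c00 alpha00 strong.
have C0 : 0 <= `|M| + 8 * alpha0 * opnorm H.
  by rewrite addr_ge0 // !mulr_ge0 ?opnorm_ge0 // ltW.
have [delta delta0 Hdelta] := exists_coupling_threshold C0 K00 eta00.
pose eta := Num.min 1 (delta / (3 * alpha0 * opnorm H + 1)).
have den0 : 0 < 3 * alpha0 * opnorm H + 1.
  by rewrite ltr_wpDl // !mulr_ge0 ?opnorm_ge0 // ltW.
have eta_gt0 : 0 < eta by rewrite lt_min ltr01 divr_gt0.
have eta_le1 : eta <= 1 by rewrite ge_min lexx.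
have small : 3 * alpha0 * opnorm H * eta <= delta.
  apply: (@le_trans _ _ ((3 * alpha0 * opnorm H + 1) * eta)).
    by rewrite ler_wpM2r ?lerDl // ltW.
  by rewrite mulrC -ler_pdivlMr // ge_min lexx orbT.
exists (eta ^+ 2) => [|n l D g D0 ln few deg]; first exact: exprn_gt0.
have VM' i (t : R) v : (1 <= i)%N -> 0 < t -> enorm (V i t *m v) <= `|M| * enorm v.
  move=> i1 t0; apply: le_trans (bounded_fields_enorm v VM i1 t0) _.
  by rewrite ler_wpM2r ?enorm_ge0 // ler_norm.
have dec := nearly_decoupled_concentrated (opnorm_ge0 H) (enorm_mulmx H) lambda0 Hlambda
  (normr_ge0 M) VM' D0 alpha00 c00 eta_gt0 eta_le1 ln few deg strong small.
have [X [Y XY]] := coupled_fundamental_pair H (alpha0 / D) g VM.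
have pairV (i : 'I_n) : exists XY : (R -> 'M[R]_d) * (R -> 'M[R]_d),
    fundamental_pair (V i.+1) XY.1 XY.2 /\ backward_contraction XY.1 XY.2 K0 eta0.
  have [Xi [Yi XYi]] := fundamental_pair_of_bounded_fields VM (isT : (1 <= i.+1)%N).
  have [T [VT HT]] := Vu i.+1 isT.
  by exists (Xi, Yi); split => //; apply: backward_contraction_of_unstable VT HT.
have /choice [XYv HXYv] := pairV.
have pidT : (pid_mx (d * l) : 'M[R]_(n * d))^T = pid_mx (d * l) by rewrite tr_pid_mx.
have dl : (d * l <= n * d)%N by rewrite mulnC leq_mul2r ln orbT.
have pid2 : (pid_mx (d * l) : 'M[R]_(n * d)) *m (pid_mx (d * l) : 'M[R]_(n * d)) =
    pid_mx (d * l).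
  exact: pid_mx_id.
rewrite -(rank_pid_mx R dl dl).
apply: (Hdelta _ _ _ _ _ _ _ _ pidT pid2 XY _ _ dec).
- exact: (fundamental_pair_blockdiag (fun i => (HXYv i).1)).
- exact: (backward_contraction_blockdiag (ltW K00) (fun i => (HXYv i).2)).
Qed.

End Assembly.

Unset Implicit Arguments.

Theorem theorem2 (R : realType) (d : nat) (hd : (1 <= d)%N)
    (H : 'M[R]_d) (hH : posdef H) (M c0 : R) :
  exists c : R, 0 < c /\
  forall (V : nat -> R -> 'M[R]_d) (w : nat -> nat -> R) (l : nat -> nat)
         (theta gamma alpha0 : R),
    bounded_fields V M ->
    uniformly_unstable V ->
    theta < (3 - Num.sqrt 5) / 2 ->
    (Num.sqrt 5 - 1) / 2 < gamma ->
    strongly_heterogeneous w l theta gamma c0 ->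
    c < alpha0 ->
    almost_every_graph w (fun n => [set g : graph n |
      exponential_dichotomy (coupled_field H V (alpha0 / wmax w n) g)
        (d * l n)]).
Proof.
have [lambda lambda0 Hlambda] := posdef_coercive hH.
(* [c] only has to give hubs the rate [`|M| + 1]: their degrees are at least
   [c0 / 4 * wmax].  The absolute values keep it positive for all [M] and [c0]. *)
exists (1 + `|4 * (`|M| + 1) / (c0 * lambda)|); split.
  by rewrite ltr_wpDr.
move=> V w l theta gamma alpha0 VM Vu _ _ het alpha_large.
have c00 : 0 < c0 by case: het => _ _ _ [/andP[]].
have alpha00 : 0 < alpha0 by apply: lt_trans alpha_large; rewrite ltr_wpDr.
have strong : `|M| + 1 <= alpha0 * (c0 / 4) * lambda.
  have cl0 : 0 < c0 * lambda by rewrite mulr_gt0.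
  have : 4 * (`|M| + 1) / (c0 * lambda) <= alpha0.
    apply: le_trans (ler_norm _) (le_trans _ (ltW alpha_large)).
    by rewrite lerDr.
  rewrite ler_pdivrMr // => h.
  have -> : alpha0 * (c0 / 4) * lambda = alpha0 * (c0 * lambda) / 4 by ring.
  by rewrite ler_pdivlMr // mulrC.
have [eps eps0 Heps] := concentrated_dichotomy lambda0 Hlambda VM Vu c00 alpha00 strong.
have good := almost_every_graph_concentrated het eps0.
apply: (squeeze_cvgr _ good (cvg_cst (1 : R))).
near=> n; have n1 : (1 <= n)%N by near: n; exact: nbhs_infty_ge.
case: (het) => -[/(_ n n1) [hw _ wsq] _ _] _ _ _ _.
have hle i : (1 <= i <= n)%N -> w n i <= wmax w n by apply: weight_le_wmax.
rewrite (graph_prob_le1 n1 hw hle wsq) andbT.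
apply: (graph_prob_sub n1 hw hle wsq) => g /= deg.
apply: (Heps n (l n)) deg.
- exact: wmax_gt0 het n n1.
- by apply: ltnW; near: n; exact: near_hubs_lt_size het.
- by near: n; exact: near_few_hubs het eps eps0.
Unshelve. all: by end_near.
Qed.
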